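(* For every real $\epsilon>0$ there is an $N$ such that for all sufficiently large $g$ $$\frac{\#\{S\mid S \text{ a numerical semigroup},\ g(S)=g,\ |F(S)-2m(S)|>N\}}{n_g}<\epsilon,$$ where $n_g$ is the number of numerical semigroups of genus $g$.
   Context: A numerical semigroup is a subset $S\subseteq\mathbb{N}=\{0,1,2,\dots\}$ that contains $0$, is closed under addition, and has finite complement in $\mathbb{N}$. The genus $g(S)$ is the number of elements of $\mathbb{N}\setminus S$. The Frobenius number $F(S)$ is the largest element of $\mathbb{N}\setminus S$. The multiplicity $m(S)$ is the smallest non-zero element of $S$. *)

(* Defs.v *)
From mathcomp Require Import all_boot all_order all_algebra finmap.
From mathcomp Require Import boolp classical_sets functions cardinality reals.

Set Implicit Arguments.
Unset Strict Implicit.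
Unset Printing Implicit Defensive.

Import Order.TTheory GRing.Theory Num.Theory.

Local Open Scope classical_set_scope.
Local Open Scope fset_scope.

Definition numerical_semigroup (S : set nat) : Prop :=
  [/\ S 0%N,
      forall a b : nat, S a -> S b -> S (a + b)%N
    & finite_set (~` S)].

Definition genus (S : set nat) : nat := #|` fset_set (~` S)|.

(* The only numerical semigroup without a largest gap is [setT], of genus 0,
   for which the default value 0 is returned. *)
Definition frobenius (S : set nat) : nat :=
  xget 0%N (~` S `&` ubound (~` S)).

Definition multiplicity (S : set nat) : nat :=
  xget 0%N ((S `\ 0%N) `&` lbound (S `\ 0%N)).

Definition semigroups_of_genus (g : nat) : set (set nat) :=
  [set S | numerical_semigroup S /\ genus S = g].

(* [fset_set] is [fset0] on infinite sets, but there are only finitely many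
   numerical semigroups of a given genus: all gaps are smaller than 2g. *)
Definition nb_semigroups (g : nat) : nat :=
  #|` fset_set (semigroups_of_genus g)|.

Definition nb_semigroups_far (N g : nat) : nat :=
  #|` fset_set [set S | semigroups_of_genus g S /\
        (N%:Z < `|(frobenius S)%:Z - 2 * (multiplicity S)%:Z|)%R]|.

(* Main.v *)
Require Import Defs.
From mathcomp Require Import all_boot all_order all_algebra.
From mathcomp Require Import reals.
From mathcomp Require Import ring lra zify.
From mathcomp Require finmap boolp classical_sets functions cardinality.

Set Implicit Arguments.
Unset Strict Implicit.
Unset Printing Implicit Defensive.

Import Order.TTheory GRing.Theory Num.Theory.

(* Let m be the multiplicity and x the inverse of the golden ratio, so that
   x + x^2 = 1. A semigroup is encoded by its Kunz word k_1 ... k_(m-1); the genus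
   is the sum of the letters, k_(i+j) <= k_i + k_j, and k_(i+j-m) <= k_i + k_j + 1.
   Every word over {1, 2} is allowed, so n_g x^g >= x, and it suffices to bound
   the total weight x^(sum of the letters) of the words of sum g that are far.

   - F < 2m - N: all letters are 1 or 2 and the last N are 1, weight at most x^N.
   - m a small fraction of g: there are few such words at all. Otherwise the
     letters are bounded, since a letter q forces (q - 1) m <= 2 g.
   - F > 2m + N without letter 4: the last 3 is at a position l > N, what follows
     is free, and the prefix has weight O(r^l) with r < 1.
   - Some letter is at least 4: the weight is O(r^m) with r < 1.

   The two exponential bounds rest on containers. If l_1, ..., l_d lie close
   together and carry a letter >= 3, no two 1's have a sum among the l_j. In this
   almost d-regular graph an independent set is confined, up to exp(o(n)) choices
   of a small fingerprint, to half of the vertices; the letters {1, 2, 3} on one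
   half and {2, 3} on the other have weight 2x * x < 1 per pair of positions. With
   letters >= 4 at the l_j the same holds between the letters <= 1 and those <= 2,
   and, by the carries, for the 1's behind the l_j. Where letters >= 3 are scarce, a
   single constraint k_i + k_j > 2 on the pairs i + j = s suffices. *)

(** * Kunz words *)

Section KunzWords.

Import finmap boolp classical_sets functions cardinality.
Local Open Scope classical_set_scope.

(* The word s lists the Kunz coordinates k_1, ..., k_(m-1) of a semigroup of
   multiplicity m = size s + 1; kunz_coord also supplies k_0 = 0. *)
Definition kunz_coord (s : seq nat) (i : nat) : nat := nth 0 (0 :: s) i.

(** The word prescribes i + k_i m as the least element of residue i modulo m. *)
Definition semi_of (s : seq nat) : set nat :=
  [set n | kunz_coord s (n %% (size s).+1) <= n %/ (size s).+1].

(** Kunz's inequalities: they express closure under addition for the least elements of the residue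
    classes, first without and then with a carry modulo m. *)
Definition kunz (s : seq nat) : Prop :=
  [/\ all (leq 1) s,
    forall i j, i + j < (size s).+1 -> kunz_coord s (i + j) <= kunz_coord s i + kunz_coord s j &
    forall i j l, i < (size s).+1 -> j < (size s).+1 -> i + j = l + (size s).+1 ->
      kunz_coord s l <= (kunz_coord s i + kunz_coord s j).+1].

Lemma divn_modn_addmul (m i t : nat) : i < m ->
  ((i + t * m) %/ m = t) * ((i + t * m) %% m = i).
Proof.
move=> im; have m0 : 0 < m by apply: leq_ltn_trans im.
by rewrite addnC divnMDl // modnMDl divn_small // modn_small // addn0.
Qed.

Lemma card_fset_set_seq (T : choiceType) (A : set T) (l : seq T) :
  uniq l -> (forall x, A x <-> x \in l) -> finite_set A /\ #|` fset_set A|%fset = size l.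
Proof.
move=> ul Al; have fA : finite_set A.
  have -> : A = [set` l] by apply/seteqP; split => x /=; rewrite -Al.
  exact: finite_seq.
split=> //; apply: perm_size; apply: uniq_perm => // x.
by rewrite in_fset_set //; apply/idP/idP => [/set_mem/Al|/Al/mem_set].
Qed.

(** The residue class of i has exactly the k_i gaps i + t m with t < k_i. *)
Lemma genus_semi_of (s : seq nat) :
  finite_set (~` semi_of s) /\ genus (semi_of s) = sumn s.
Proof.
set m := (size s).+1.
pose l := [seq i + t * m | i <- iota 0 m, t <- iota 0 (kunz_coord s i)].
have lP n : (~` semi_of s) n <-> n \in l.
  split=> [/= /negP|/allpairsPdep[i [t [hi ht ->]]]].
    rewrite -ltnNge => h; apply/allpairsPdep; exists (n %% m), (n %/ m); split.
    - by rewrite mem_iota ltn_mod.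
    - by rewrite mem_iota.
    - by rewrite addnC -divn_eq.
  rewrite !mem_iota /= !add0n in hi ht *.
  by rewrite /semi_of /= !divn_modn_addmul //; apply/negP; rewrite -ltnNge.
have ul : uniq l.
  apply: allpairs_uniq_dep => [|i _|[i t] [j u]]; rewrite ?iota_uniq //.
  case/allpairsPdep=> i' [t' [hi' _ /(congr1 tag) Ei]].
  case/allpairsPdep=> j' [u' [hj' _ /(congr1 tag) Ej]] E.
  rewrite /= in Ei; rewrite /= in Ej; rewrite /= in E.
  rewrite -Ei mem_iota add0n in hi'; rewrite -Ej mem_iota add0n in hj'.
  have := congr1 (modn^~ m) E; have := congr1 (divn^~ m) E.
  by rewrite !divn_modn_addmul // => -> ->.
have [fin cE] := card_fset_set_seq ul lP; split => //.
rewrite /genus cE size_allpairs_dep.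
have -> : [seq size (iota 0 (kunz_coord s i)) | i <- iota 0 m] = 0 :: s.
  by under eq_map => i do rewrite size_iota; exact: (mkseq_nth 0 (0 :: s)).
by [].
Qed.

Lemma semi_ofE (s : seq nat) (i t : nat) : i < (size s).+1 ->
  semi_of s (i + t * (size s).+1) <-> kunz_coord s i <= t.
Proof. by move=> hi; rewrite /semi_of /= !divn_modn_addmul. Qed.

Lemma kunz_coord_gt0 (s : seq nat) (i : nat) : all (leq 1) s -> 0 < i -> i < (size s).+1 ->
  0 < kunz_coord s i.
Proof. by case: i => // i /(all_nthP 0) h _; rewrite ltnS => /h. Qed.

Lemma multiplicity_semi_of (s : seq nat) : all (leq 1) s ->
  multiplicity (semi_of s) = (size s).+1.
Proof.
move=> hs; set m := (size s).+1.
have Sm : semi_of s m by rewrite /semi_of /= modnn divnn.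
have mmin n : semi_of s n -> n <> 0 -> m <= n.
  move=> Sn n0; rewrite leqNgt; apply/negP => nm.
  have := @semi_ofE s n 0 nm; rewrite mul0n addn0 => -[/(_ Sn)] h _.
  by have := kunz_coord_gt0 hs _ nm; lia.
apply: xget_unique => [|n [[Sn n0] hn]]; first by split=> // n [Sn]; exact: mmin.
apply/eqP; rewrite eqn_leq mmin //.
by rewrite andbT; exact: (hn m).
Qed.

(** The multiplicity determines the length of the word, and k_i is the least t such that i + t m is
    in the set. *)
Lemma semi_of_inj (s s' : seq nat) : all (leq 1) s -> all (leq 1) s' ->
  semi_of s = semi_of s' -> s = s'.
Proof.
move=> hs hs' E; have : multiplicity (semi_of s) = multiplicity (semi_of s') by rewrite E.
rewrite !multiplicity_semi_of // => -[Es].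
apply: (@eq_from_nth _ 0) => // i hi.
have h t : kunz_coord s i.+1 <= t <-> kunz_coord s' i.+1 <= t.
  by rewrite -!semi_ofE -?Es // E.
by apply/eqP; rewrite eqn_leq; apply/andP; split; [apply/(h _).2|apply/(h _).1].
Qed.

(** Take for m the least positive element and for k_i the least t with i + t m in S; both exist
    since S is cofinite. Adding m repeatedly shows that all larger t occur too. *)
Lemma semigroup_word (S : set nat) : numerical_semigroup S ->
  exists2 s, kunz s & S = semi_of s.
Proof.
move=> [S0 SD Sfin].
have [B hB] : exists B, forall n, B <= n -> S n.
  have /finite_seqP[l lE] := Sfin.
  exists (\max_(i <- l) i).+1 => n hn; apply: contrapT => nS.
  have : (~` S) n by [].
  rewrite lE /= => nl.
  have : n <= \max_(i <- l) i by exact: (@leq_bigmax_seq _ l xpredT id n nl isT).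
  by rewrite leqNgt hn.
have exm : exists n, (0 < n) && `[< S n >].
  by exists B.+1; apply/andP; split => //; apply/asboolP; exact: hB.
case: (ex_minnP exm) => m /andP[m0 /asboolP Sm] mmin.
have exk i : exists t, `[< S (i + t * m) >].
  exists B; apply/asboolP; apply: hB; nia.
pose k i := ex_minn (exk i).
have kP i t : S (i + t * m) <-> k i <= t.
  rewrite /k; case: ex_minnP => u /asboolP hu umin; split; first by move/asboolP/umin.
  move=> ut; rewrite -(subnKC ut) mulnDl addnA; apply: (SD) => //.
  elim: (t - u) => [|v IH]; first by rewrite mul0n.
  by rewrite mulSn; exact: SD.
have kk i : S (i + k i * m) by apply/kP.
have k0 : k 0 = 0 by apply/eqP; rewrite -leqn0; apply/kP.
have kpos i : 0 < i -> i < m -> 0 < k i.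
  move=> i0 im; rewrite lt0n; apply/negP => /eqP k_0.
  have : S i by have := kk i; rewrite k_0 mul0n addn0.
  by move/asboolP => Si; have := mmin i; rewrite i0 Si => /(_ isT); rewrite leqNgt im.
pose s := [seq k i | i <- iota 1 m.-1].
have sz : (size s).+1 = m by rewrite size_map size_iota prednK.
have ks i : i < m -> kunz_coord s i = k i.
  case: i => [|i] im; first by rewrite k0.
  by rewrite /kunz_coord /= (nth_map 0) ?size_iota ?nth_iota //; lia.
exists s; last first.
  apply/seteqP; split => n; rewrite /semi_of /= sz ks ?ltn_mod //.
    by rewrite {1}(divn_eq n m) addnC => /kP.
  by move=> h; rewrite (divn_eq n m) addnC; apply/kP.
split=> [|i j|i j l]; rewrite ?sz.
- by apply/allP => a /mapP[i]; rewrite mem_iota => hi ->; apply: kpos; lia.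
- move=> h; rewrite !ks; [|lia|lia|lia].
  apply/kP; rewrite mulnDl addnACA; exact: SD.
- move=> hi hj E; rewrite !ks; [|lia|lia|lia].
  apply/kP; rewrite (_ : l + _ = (i + k i * m) + (j + k j * m)); first exact: SD.
  by rewrite mulSn mulnDl; lia.
Qed.

(** Two elements that are not multiples of m have quotients at least 1, so their sum has quotient at
    least 2, which no letter exceeds. Adding a multiple of m keeps the residue and does not lower
    the quotient. *)
Lemma numerical_semi_of_12 (s : seq nat) : all [pred a | 1 <= a <= 2] s ->
  numerical_semigroup (semi_of s).
Proof.
move=> hs; have [fin _] := genus_semi_of s; split => //.
have hs1 : all (leq 1) s by apply: sub_all hs => a /andP[].
have k2 i : kunz_coord s i <= 2.
  case: i => // i; rewrite /kunz_coord /=; case: (ltnP i (size s)) => h.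
    by have /allP/(_ _ (mem_nth 0 h))/andP[] := hs.
  by rewrite nth_default.
move=> a b; rewrite /semi_of /=; set m := (size s).+1 => ha hb.
have am : a %% m < m by rewrite ltn_mod.
have bm : b %% m < m by rewrite ltn_mod.
have ea := divn_eq a m; have eb := divn_eq b m.
move: (a %% m) (a %/ m) (b %% m) (b %/ m) ha hb am bm ea eb => i u j v ha hb im jm -> ->.
rewrite addnACA -mulnDl addnC.
have [i0|i0] := posnP i.
  by rewrite i0 add0n divn_modn_addmul // (leq_trans hb) // divn_modn_addmul // leq_addl.
have [j0|j0] := posnP j.
  by rewrite j0 addn0 divn_modn_addmul // divn_modn_addmul // (leq_trans ha) // leq_addr.
have u1 : 0 < u by apply: leq_trans ha; exact: kunz_coord_gt0.
have v1 : 0 < v by apply: leq_trans hb; exact: kunz_coord_gt0.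
apply: leq_trans (k2 _) _; rewrite addnC divnMDl //.
by apply: leq_trans (leq_addr _ _); lia.
Qed.

(** * Words of semigroups with F far from 2m *)

Definition far_low (N : nat) (s : seq nat) : bool :=
  all (leq^~ 2) s && all (pred1 1) (drop (size s - N) s).

(** Positions count from 1, as in [kunz_coord], so [drop l s] lists the letters behind the last
    3. *)
Definition far_mid (N : nat) (s : seq nat) : bool :=
  all (leq^~ 3) s && [exists l : 'I_(size s).+1,
    [&& N < l, kunz_coord s l == 3 & all (leq^~ 2) (drop l s)]].

Definition far_high (s : seq nat) : bool := has (leq 4) s.

(** The guard in the second part is for a set without gaps, where [frobenius] returns 0. *)
Lemma frobeniusP (S : set nat) : finite_set (~` S) ->
  (forall n, ~ S n -> n <= frobenius S) /\ (0 < frobenius S -> ~ S (frobenius S)).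
Proof.
move=> /finite_seqP[l lE]; have nSl n : ~ S n -> n \in l by move=> h; have : (~` S) n by []; rewrite lE.
have bnd n : `[< ~ S n >] -> n <= \max_(i <- l) i.
  by move/asboolP/nSl => nl; exact: (@leq_bigmax_seq _ l xpredT id n nl isT).
case: (pselect (exists n, ~ S n)) => [[n nS]|noS].
  have exn : exists n, `[< ~ S n >] by exists n; apply/asboolP.
  case: (ex_maxnP exn bnd) => M /asboolP MS Mmax.
  have hM : (~` S `&` ubound (~` S)) M.
    by split => // j nj; apply: Mmax; apply/asboolP.
  have [h1 h2] : (~` S `&` ubound (~` S)) (frobenius S) by exact: xgetI hM.
  by split => // j nj; exact: h2.
have -> : frobenius S = 0 by apply: xgetPN => j [nj _]; apply: noS; exists j.
by split => // j nj; case: noS; exists j.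
Qed.

(** A letter q at position i makes i + (q - 1) m a gap, hence at most F; conversely a gap F with
    residue l and quotient t forces k_l > t. *)
Lemma far_word (N : nat) (s : seq nat) : all (leq 1) s ->
  (N%:Z < `|(frobenius (semi_of s))%:Z - 2 * (multiplicity (semi_of s))%:Z|)%R ->
  [|| far_low N s, far_mid N s | far_high s].
Proof.
move=> s1; rewrite multiplicity_semi_of //.
have [fin _] := genus_semi_of s; have [Fmax Fgap] := frobeniusP fin.
have m0 : 0 < (size s).+1 by [].
have gapP i t : i < size s -> t < nth 0 s i -> i.+1 + t * (size s).+1 <= frobenius (semi_of s).
  move=> hi ht; apply: Fmax => /(semi_ofE (s := s)).
  by rewrite /kunz_coord /= ltnS => /(_ hi); rewrite leqNgt ht.
move: (frobenius _) Fmax Fgap gapP => F Fmax Fgap gapP hF.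
have [Flt|Fge] := ltnP F (2 * (size s).+1).
  have {hF}hF : F + N < 2 * (size s).+1 by lia.
  apply/orP; left; apply/andP; split; apply/(all_nthP 0) => i.
    move=> hi; rewrite leqNgt; apply/negP => h.
    have := gapP i 2 hi h; lia.
  rewrite size_drop => hi; rewrite nth_drop.
  have hi' : size s - N + i < size s by lia.
  have /(all_nthP 0)/(_ _ hi') /= h1 := s1.
  rewrite /= eqn_leq h1 andbT leqNgt; apply/negP => h.
  have := gapP _ 1 hi' h; lia.
have {hF}hF : 2 * (size s).+1 + N < F by lia.
have [_|] := boolP (far_high s); first by rewrite !orbT.
rewrite /far_high -all_predC => /(all_nthP 0) h3.
have {}h3 i : i < size s -> nth 0 s i <= 3 by move=> /h3 /=; rewrite -ltnNge.
rewrite orbF; apply/orP; right; apply/andP; split; first by apply/(all_nthP 0).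
have lm : F %% (size s).+1 < (size s).+1 by rewrite ltn_mod.
have gF : F %/ (size s).+1 < kunz_coord s (F %% (size s).+1).
  rewrite ltnNge; apply/negP => h; apply: Fgap; first lia.
  exact: h.
have eF := divn_eq F (size s).+1.
move: (F %/ (size s).+1) (F %% (size s).+1) lm gF eF => t l lm gF eF.
have k3 : kunz_coord s l <= 3 by move: lm; rewrite /kunz_coord; case: (l) => //= l'; rewrite ltnS => /h3.
(* Letters at most 3 give t <= 2, and F > 2m excludes smaller values. *)
have t2 : t = 2.
  have tl : t <= 2 by lia.
  by case: t tl eF {gF} => [|[|[|]]] // _ eF; lia.
apply/existsP; exists (Ordinal lm); rewrite /=; apply/and3P; split; [lia|lia|].
apply/(all_nthP 0) => j; rewrite size_drop => hj; rewrite nth_drop leqNgt; apply/negP => h.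
have lj : l + j < size s by lia.
by have := gapP _ 2 lj h; lia.
Qed.

Definition incr_head (s : seq nat) : seq nat :=
  if s is a :: s' then a.+1 :: s' else [::].

(** A composition of g + 1 starts with a new part 1 or enlarges the first part of a composition of
    g. The empty word is fixed by [incr_head] and causes spurious entries, harmless where only an
    upper bound is wanted. *)
Fixpoint compositions (g : nat) : seq (seq nat) :=
  if g is g'.+1 then
    [seq 1 :: s | s <- compositions g'] ++ [seq incr_head s | s <- compositions g']
  else [:: [::]].

Lemma mem_compositions (s : seq nat) : all (leq 1) s -> s \in compositions (sumn s).
Proof.
move: {2}(sumn s) (erefl (sumn s)) => g; elim: g s => [|g IH] [|[|a] s] E h //.
rewrite E /= mem_cat; case: a E h => [|a] E h; apply/orP; [left|right].
  have Es : sumn s = g by move: E => [].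
  by apply: map_f; rewrite -Es; exact: IH.
have -> : a.+2 :: s = incr_head (a.+1 :: s) by [].
apply: map_f; have Es : sumn (a.+1 :: s) = g by move: E => [].
by rewrite -Es; apply: IH.
Qed.

(** This reduces the theorem to counting words: [Ws] consists of the words of all semigroups of
    genus g, and the later estimates use nothing else about semigroups. *)
Lemma words_of_genus (g : nat) : exists Ws : seq (seq nat),
  [/\ uniq Ws, size Ws = nb_semigroups g,
      forall N, nb_semigroups_far N g <=
        count (fun s => [|| far_low N s, far_mid N s | far_high s]) Ws,
      forall s : seq nat, s \in Ws -> kunz s /\ sumn s = g &
      forall s : seq nat, all [pred a | 1 <= a <= 2] s -> sumn s = g -> s \in Ws].
Proof.
pose wd (U : set nat) : seq nat := xget [::] [set s | kunz s /\ U = semi_of s].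
have wdP U : numerical_semigroup U -> kunz (wd U) /\ U = semi_of (wd U).
  move=> /semigroup_word[s ks Ss].
  exact: (@xgetPex _ [::] [set s | kunz s /\ U = semi_of s]) (ex_intro _ s (conj ks Ss)).
set A := semigroups_of_genus g.
have wdA U : A U -> [/\ kunz (wd U), U = semi_of (wd U) & sumn (wd U) = g].
  move=> [/wdP[kS SE] gS]; split => //; rewrite -gS [in RHS]SE.
  by have [_ ->] := genus_semi_of (wd U).
have finA : finite_set A.
  apply: (@sub_finite_set _ _ (semi_of @` [set` compositions g])).
    move=> U /wdA[[h _ _] SE sg]; exists (wd U) => //=.
    by rewrite -sg; exact: mem_compositions.
  by apply: finite_image; exact: finite_seq.
have wd_inj U U' : A U -> A U' -> wd U = wd U' -> U = U'.
  by move=> /wdA[_ e _] /wdA[_ e' _] E; rewrite e e' E.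
exists [seq wd U | U <- fset_set A]; split.
- rewrite map_inj_in_uniq ?fset_uniq // => U U'.
  rewrite !in_fset_set // => /set_mem AS /set_mem AS'; exact: wd_inj.
- by rewrite size_map.
- move=> N; pose B := [set U | A U /\
    (N%:Z < `|(frobenius U)%:Z - 2 * (multiplicity U)%:Z|)%R].
  have finB : finite_set B by apply: sub_finite_set finA => U [].
  rewrite /nb_semigroups_far -/B -size_filter -(size_map wd).
  apply: uniq_leq_size.
    rewrite map_inj_in_uniq ?fset_uniq // => U U'.
    by rewrite !in_fset_set // => /set_mem[AS _] /set_mem[AS' _]; exact: wd_inj.
  move=> _ /mapP[U] + ->; rewrite in_fset_set // => /set_mem[AS far].
  rewrite mem_filter map_f ?in_fset_set ?mem_set // andbT.
  have [[s1 _ _] SE _] := wdA U AS; rewrite SE in far.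
  exact: far_word.
- move=> _ /mapP[U] + ->; rewrite in_fset_set // => /set_mem /wdA[kS _ sg].
  by split.
- move=> s s12 sg; have nS := numerical_semi_of_12 s12.
  have AS : A (semi_of s) by split => //; have [_ ->] := genus_semi_of s.
  have s1 : all (leq 1) s by apply: sub_all s12 => a /andP[].
  have [[w1 _ _] wE _] := wdA _ AS.
  rewrite (semi_of_inj s1 w1 wE); apply: map_f.
  by rewrite in_fset_set // mem_set.
Qed.

End KunzWords.

(** * Containers *)

Definition nbrs (T : finType) (N : T -> {set T}) (F : {set T}) : {set T} :=
  \bigcup_(i in F) N i.

(** The container of the fingerprint F; it is determined by F without knowledge of the independent
    set. *)
Definition few_new (T : finType) (N : T -> {set T}) (I F : {set T}) (e : nat) :
  {set T} := [set i in I | #|N i :\: nbrs N F| < e].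

(** Double count the edges between the container and C = [nbrs N F]: each vertex of the container
    sends at least d - e edges into C, and each vertex of C receives at most d. *)
Lemma card_few_new (T : finType) (N : T -> {set T}) (I F : {set T}) (d e : nat) :
  (forall i, i \in I -> #|N i| = d) ->
  (forall j, #|[set i in I | j \in N i]| <= d) ->
  #|few_new N I F e| * (d - e) <= d * #|nbrs N F|.
Proof.
move=> hN hdeg; set C := nbrs N F; set Z := few_new N I F e.
apply: (@leq_trans (\sum_(i in Z) #|N i :&: C|)).
  rewrite -sum_nat_const; apply: leq_sum => i; rewrite inE => /andP[iI lti].
  rewrite leq_subLR -(hN i iI) -(cardsID C (N i)) addnC leq_add2r.
  exact: ltnW.
have -> : \sum_(i in Z) #|N i :&: C| =
          \sum_(j in C) #|[set i in Z | j \in N i]|.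
  under eq_bigr => i _ do rewrite -sum1_card.
  under [RHS]eq_bigr => j _ do rewrite -sum1_card.
  rewrite (exchange_big_dep (mem C)) /=; last by move=> i j _; rewrite inE => /andP[].
  apply: eq_bigr => j jC; apply: eq_bigl => i.
  by rewrite !inE jC andbT.
rewrite mulnC -sum_nat_const; apply: leq_sum => j _.
apply: leq_trans (hdeg j); apply: subset_leq_card.
by apply/subsetP => i; rewrite !inE => /andP[/andP[-> _] ->].
Qed.

(* F is a maximal subset of X :&: I each of whose elements accounts for at
   least e new neighbours. *)
Lemma fingerprint (T : finType) (N : T -> {set T}) (I X Y : {set T}) (e : nat) :
  0 < e -> (forall i j, i \in X -> j \in N i -> j \notin Y) ->
  exists F : {set T}, [/\ F \subset I, #|F| * e <= #|T|,
    X :&: I \subset few_new N I F e & [disjoint nbrs N F & Y]].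
Proof.
move=> e0 hXY.
pose ok (F : {set T}) := (F \subset X :&: I) && (#|F| * e <= #|nbrs N F|).
have ok0 : ok set0 by rewrite /ok sub0set cards0.
have [F okF Fmax] := @arg_maxnP _ set0 ok (fun F => #|F|) ok0.
case/andP: (okF) => FXI hF; exists F; split.
- exact: subset_trans FXI (subsetIr _ _).
- by apply: leq_trans hF _; exact: max_card.
- apply/subsetP => i iXI; rewrite inE; case/setIP: (iXI) => iX -> /=.
  rewrite ltnNge; apply/negP => hnew.
  have iF : i \notin F.
    apply/negP => iF.
    have h0 : N i :\: nbrs N F = set0.
      by apply/eqP; rewrite setD_eq0; exact: bigcup_sup.
    by move: hnew; rewrite h0 cards0 leqNgt e0.
  have : ok (i |: F).
    apply/andP; split; first by rewrite subUset sub1set iXI.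
    rewrite /nbrs bigcup_setU big_set1 cardsU1 iF mulnDl mul1n.
    rewrite -/(nbrs N F) -(cardsID (nbrs N F) (N i :|: _)) setDUl setDv setU0.
    rewrite addnC; apply: leq_add => //; apply: leq_trans hF _.
    by apply: subset_leq_card; rewrite subsetI subsetUr subxx.
  by move/Fmax => /=; rewrite cardsU1 iF add1n ltnn.
- rewrite disjoint_subset; apply/subsetP => j /bigcupP[i iF jN].
  by move/subsetP: FXI => /(_ i iF) /setIP[iX _]; apply: hXY jN.
Qed.

Lemma subset_of_card (T : finType) (A : {set T}) (d : nat) :
  d <= #|A| -> exists2 P : {set T}, P \subset A & #|P| = d.
Proof.
move=> dA; exists [set:: take d (enum A)].
  by apply/subsetP => i; rewrite inE => /mem_take; rewrite mem_enum.
rewrite cardsE; have /card_uniqP -> : uniq (take d (enum A)).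
  by rewrite take_uniq // enum_uniq.
by rewrite size_takel // -cardE.
Qed.

(* b - 1 is the last of the K blocks of length n %/ K + 1 that contains at least
   d elements of E; b = 0 when there is no such block. *)
Lemma last_dense_block (n K d : nat) (E : {set 'I_n}) : 0 < K ->
  exists b, [/\ b <= K, #|[set i in E | b * (n %/ K).+1 <= i]| <= K * d &
    0 < b -> exists P : {set 'I_n}, [/\ P \subset E, #|P| = d &
      forall p, p \in P -> b.-1 * (n %/ K).+1 <= p < b * (n %/ K).+1]].
Proof.
move=> K0; set w := (n %/ K).+1.
pose tail b := [set i in E | b * w <= i].
(* The bound drops by d with each block, so at the least b that satisfies it the block just before
   has at least d elements. *)
pose ok b := #|tail b| <= (K - b) * d.
have okK : ok K.
  rewrite /ok (_ : tail K = set0) ?cards0 //.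
  apply/setP => i; rewrite !inE; apply/negbTE; rewrite negb_and -ltnNge.
  have : n < K * w by rewrite mulnC -ltn_divLR.
  by move/(ltn_trans (ltn_ord i)) => ->; rewrite orbT.
have [b okb bmin] := ex_minnP (ex_intro ok K okK).
have bK := bmin _ okK.
exists b; split=> //.
  by apply: leq_trans okb _; rewrite leq_mul2r leq_subr orbT.
case: b okb bmin bK => // b okb bmin bK _ /=.
have : d <= #|tail b :\: tail b.+1|.
  have : ~~ ok b by apply/negP => /bmin; rewrite ltnn.
  rewrite /ok -ltnNge => h.
  rewrite cardsD (_ : tail b :&: _ = tail b.+1).
    move: okb h; rewrite /ok -(subnSK bK) mulSn => okb h.
    rewrite leq_subRL; first by rewrite addnC; apply: leq_trans (ltnW h); rewrite leq_add2l.
    by apply: leq_trans okb _; apply: leq_trans (ltnW h); rewrite leq_addl.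
  apply/setIidPr/subsetP => i; rewrite !inE => /andP[-> /=].
  by apply: leq_trans; rewrite leq_mul2r leqnSn orbT.
case/subset_of_card => P /subsetP PS Pd; exists P; split => //.
  by apply/subsetP => i /PS; rewrite !inE => /and3P[].
by move=> i /PS; rewrite !inE negb_and -ltnNge => /and3P[/orP[/negP//|->] _ ->].
Qed.

Local Open Scope ring_scope.

(** * Counting and geometric decay *)

Lemma bernoulli_ge (R : realType) (y : R) (k : nat) :
  -1 <= y -> 1 + y *+ k <= (1 + y) ^+ k.
Proof.
move=> hy; elim: k => [|k IH]; first by rewrite mulr0n addr0 expr0.
rewrite exprS mulrS; apply: le_trans (ler_wpM2l _ IH); last by lra.
have : 0 <= y * (y *+ k) by rewrite mulrnAr mulrn_wge0 // -expr2 sqr_ge0.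
by lra.
Qed.

Lemma expr_absorb (R : realType) (a r : R) :
  0 < r -> r < 1 -> exists k, a * r ^+ k <= 1.
Proof.
move=> r0 r1; have d0 : 0 < r^-1 - 1 by rewrite subr_gt0 invf_gt1.
have [k hk] : exists k : nat, a / (r^-1 - 1) < k%:R.
  exists (Num.bound `|a / (r^-1 - 1)|).
  exact: le_lt_trans (ler_norm _) (archi_boundP (normr_ge0 _)).
exists k; have := @bernoulli_ge R (r^-1 - 1) k.
rewrite ltr_pdivrMr // in hk.
rewrite -ler_pdivlMr ?exprn_gt0 // div1r -exprVn (_ : 1 + (r^-1 - 1) = r^-1); last by ring.
by rewrite -mulr_natl => H; have := H ltac:(lra); lra.
Qed.

(** Splits a decay rate b into k equal factors r < 1, to be spent separately on the various error
    terms. By Bernoulli's inequality r = 1 - (1 - b) / (k + 1) will do. *)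
Lemma root_above (R : realType) (b : R) (k : nat) :
  0 < b -> b < 1 -> exists r, [/\ 0 < r, r < 1 & b <= r ^+ k].
Proof.
move=> b0 b1; have k1 : 1 <= k.+1%:R :> R by rewrite ler1n.
have kS : k%:R = k.+1%:R - 1 :> R by rewrite -natr1 addrK.
move: (k.+1%:R) k1 kS => y k1 kS.
exists (1 + (b - 1) / y); set q := (b - 1) / y.
have h1 : q * y = b - 1 by rewrite divfK // gt_eqF //; lra.
have h2 : q < 0 by nra.
have h3 : -1 < q by nra.
split; [lra|lra|].
apply: le_trans (bernoulli_ge k (ltW h3)).
by rewrite -mulr_natr kS; nra.
Qed.

Lemma sum_geometric_le (R : realType) (r : R) (a b : nat) :
  0 < r -> r < 1 -> \sum_(a <= l < b) r ^+ l <= r ^+ a / (1 - r).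
Proof.
move=> r0 r1; rewrite ler_pdivlMr ?subr_gt0 //.
case: (leqP a b) => [ab|/ltnW ba]; last first.
  by rewrite big_geq // mul0r exprn_ge0 // ltW.
suff -> : (\sum_(a <= l < b) r ^+ l) * (1 - r) = r ^+ a - r ^+ b.
  by rewrite gerBl exprn_ge0 // ltW.
rewrite mulr_suml (@telescope_sumr_eq _ _ _ (fun l => - r ^+ l)) //.
  by rewrite opprK addrC.
by move=> l _; rewrite exprS; ring.
Qed.

(** The sum of z^|F| over all subsets F is (1 + z)^|T|, and each small subset contributes at least
    z^f. *)
Lemma card_small_subsets (R : realType) (T : finType) (z : R) (f : nat) :
  0 <= z -> z <= 1 ->
  #|[set F : {set T} | (#|F| <= f)%N]|%:R * z ^+ f <= (1 + z) ^+ #|T|.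
Proof.
move=> z0 z1.
have -> : (1 + z) ^+ #|T| = \sum_(F : {set T}) z ^+ #|F|.
  rewrite addrC -prodr_const bigA_distr; apply: eq_bigr => F _.
  by rewrite -big_mkcond /= prodr_const.
rewrite (bigID (fun F : {set T} => (#|F| <= f)%N)) /=.
apply: ler_wpDr; first by apply: sumr_ge0 => F _; rewrite exprn_ge0.
rewrite mulr_natl -sumr_const (eq_bigl _ _ (in_set _)).
by apply: ler_sum => F hF; rewrite ler_wiXn2l.
Qed.

Lemma exists_slack (R : realType) (r : R) : 0 < r -> r < 1 ->
  exists z : R, [/\ 0 < z, z <= 1 & (1 + z) * r <= 1].
Proof.
move=> r0 r1; exists (1 - r); split; [lra|lra|].
rewrite -subr_ge0 (_ : _ - _ = (1 - r) ^+ 2); last by ring.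
exact: sqr_ge0.
Qed.

(** Sets of bounded size are polynomially many in n. With (1 + z) r <= 1 the preceding count gives
    the constant z^(-D). *)
Lemma few_subsets (R : realType) (r : R) (D : nat) : 0 < r -> r < 1 ->
  exists2 C : R, 0 <= C & forall n : nat,
    #|[set F : {set 'I_n} | (#|F| <= D)%N]|%:R * r ^+ n <= C.
Proof.
move=> r0 r1; have [z [z0 z1 hz]] := exists_slack r0 r1.
exists (z ^- D); first by rewrite invr_ge0 exprn_ge0 // ltW.
move=> n; have := card_small_subsets 'I_n D (ltW z0) z1.
rewrite card_ord -ler_pdivlMr ?exprn_gt0 // => h.
apply: le_trans (ler_wpM2r _ h) _; first by rewrite exprn_ge0 // ltW.
rewrite mulrAC -exprMn ler_piMl ?invr_ge0 ?exprn_ge0 ?(ltW z0) //.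
by rewrite exprn_ile1 // mulr_ge0 ?(ltW r0) // addr_ge0 // ltW.
Qed.

(** With s^2 >= r, one factor s^n pays for (1 + z)^n; the other is at most z^f once s^e <= z. *)
Lemma sparse_bound (R : realType) (r : R) : 0 < r -> r < 1 ->
  exists z : R, exists2 e : nat, (0 < e)%N & [/\ 0 < z, z <= 1 &
    forall n f : nat, (f * e <= n)%N -> r ^+ n * (1 + z) ^+ n <= z ^+ f].
Proof.
move=> r0 r1; have [s [s0 s1 hs]] := root_above 2 r0 r1.
have [z [z0 z1 hz]] := exists_slack s0 s1.
have [e0 he0] := expr_absorb z^-1 s0 s1; exists z, e0.+1 => //; split=> // n f hf.
have he : s ^+ e0.+1 <= z.
  rewrite mulrC ler_pdivrMr // mul1r in he0.
  by rewrite exprS; apply: le_trans he0; rewrite ler_piMl ?exprn_ge0 // ltW.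
apply: (@le_trans _ _ (s ^+ n * (s ^+ n * (1 + z) ^+ n))).
  rewrite mulrA ler_wpM2r ?exprn_ge0 ?addr_ge0 ?(ltW z0) //.
  by rewrite -exprMn -expr2 lerXn2r // nnegrE ?exprn_ge0 // ltW.
apply: (@le_trans _ _ (s ^+ n)).
  rewrite ler_piMr ?exprn_ge0 ?(ltW s0) // -exprMn mulrC.
  by rewrite exprn_ile1 // mulr_ge0 ?(ltW s0) // addr_ge0 // ltW.
apply: (@le_trans _ _ ((s ^+ e0.+1) ^+ f)).
  by rewrite -exprM ler_wiXn2l ?(ltW s0) ?(ltW s1) // mulnC.
by rewrite lerXn2r // nnegrE ?exprn_ge0 // ltW.
Qed.

(** Counts fingerprints: sets of size at most n / e number at most r^(-n) when e is large. *)
Lemma sparse_subsets (R : realType) (r : R) : 0 < r -> r < 1 ->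
  exists2 e : nat, (0 < e)%N & forall n : nat,
    #|[set F : {set 'I_n} | (#|F| * e <= n)%N]|%:R * r ^+ n <= 1.
Proof.
move=> r0 r1; have [z [e e0 [z0 z1 hz]]] := sparse_bound r0 r1.
exists e => // n; set f := (n %/ e)%N.
have -> : [set F : {set 'I_n} | (#|F| * e <= n)%N] =
          [set F : {set 'I_n} | (#|F| <= f)%N].
  by apply/setP => F; rewrite !inE leq_divRL.
have := card_small_subsets 'I_n f (ltW z0) z1; rewrite card_ord => h.
have zf : 0 < z ^+ f by rewrite exprn_gt0.
rewrite -(ler_pM2r zf) mul1r mulrAC.
apply: le_trans (hz n f (leq_trunc_div _ _)).
by rewrite mulrC ler_wpM2l // exprn_ge0 // ltW.
Qed.

(** Union bound over the labels t. By distributivity the product of letter sums of t is a sum over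
    all words, in which the term of k is at least w k if t is the label of k. *)
Lemma sum_words_cover (R : realType) (n Q : nat) (T : finType)
    (P : pred {ffun 'I_n -> 'I_Q.+1}) (w : {ffun 'I_n -> 'I_Q.+1} -> R)
    (A : {set T}) (q : T -> 'I_n -> 'I_Q.+1 -> R) (M : R) :
  (forall t i a, 0 <= q t i a) ->
  (forall k, P k -> exists2 t, t \in A & w k <= \prod_i q t i (k i)) ->
  (forall t, t \in A -> \prod_i \sum_a q t i a <= M) ->
  \sum_(k | P k) w k <= #|A|%:R * M.
Proof.
move=> q0 hcov hM.
apply: (@le_trans _ _ (\sum_(t in A) \prod_i \sum_a q t i a)); last first.
  by rewrite mulr_natl -sumr_const; apply: ler_sum.
under [leRHS]eq_bigr => t _ do rewrite bigA_distr_bigA.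
rewrite exchange_big /= [leRHS](bigID P) /=.
apply: ler_wpDr.
  by apply: sumr_ge0 => k _; apply: sumr_ge0 => t _; apply: prodr_ge0.
apply: ler_sum => k Pk; have [t tA ht] := hcov k Pk.
rewrite (bigD1 t) //=; apply: ler_wpDr => //.
by apply: sumr_ge0 => u _; apply: prodr_ge0.
Qed.

(* The inverse of the golden ratio. *)
Definition gold (R : realType) : R := (Num.sqrt 5 - 1) / 2.

Lemma goldE (R : realType) : gold R ^+ 2 = 1 - gold R.
Proof.
have h : Num.sqrt 5 ^+ 2 = 5 :> R by rewrite sqr_sqrtr.
rewrite /gold; set s := Num.sqrt 5 in h *.
have -> : ((s - 1) / 2) ^+ 2 = (s ^+ 2 - 2 * s + 1) / 4 by field.
by rewrite h; field.
Qed.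

Lemma gold_bounds (R : realType) : 3 / 5 < gold R < 5 / 8.
Proof.
have h : Num.sqrt 5 ^+ 2 = 5 :> R by rewrite sqr_sqrtr.
have h0 : 0 <= Num.sqrt 5 :> R by exact: sqrtr_ge0.
rewrite /gold; set s := Num.sqrt 5 in h h0 *.
by apply/andP; split; nra.
Qed.

Lemma gold_gt0 (R : realType) : 0 < gold R.
Proof. by have /andP[h _] := gold_bounds R; lra. Qed.

Lemma gold_lt1 (R : realType) : gold R < 1.
Proof. by have /andP[_ h] := gold_bounds R; lra. Qed.

Lemma sum_letters_le (R : realType) (Q lo hi : nat) (f : nat -> R) :
  (forall a, 0 <= f a) ->
  \sum_(a < Q.+1) (lo <= a <= hi)%N%:R * f a <= \sum_(lo <= a < hi.+1) f a.
Proof.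
move=> f0; set N := maxn Q.+1 hi.+1.
rewrite (big_ord_widen N (fun a : nat => (lo <= a <= hi)%N%:R * f a)) ?leq_maxl //.
apply: (@le_trans _ _ (\sum_(a < N) (lo <= a <= hi)%N%:R * f a)).
  rewrite [leRHS](bigID (fun i : 'I_N => (i < Q.+1)%N)) /=.
  by apply: ler_wpDr => //; apply: sumr_ge0 => a _; rewrite mulr_ge0.
rewrite (big_nat_widenl lo 0) // (big_nat_widen 0 _ N) ?leq_maxr // big_mkord.
rewrite [leRHS]big_mkcond; apply: ler_sum => a _.
by rewrite ltnS; case: (lo <= a)%N; case: (a <= hi)%N; rewrite /= ?mul1r ?mul0r.
Qed.

Lemma sum_gold_from (R : realType) (Q c : nat) : (c <= Q.+1)%N ->
  (\sum_(c <= a < Q.+1) gold R ^+ a) * gold R ^+ 2 = gold R ^+ c - gold R ^+ Q.+1.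
Proof.
move=> cQ; rewrite goldE mulr_suml (@telescope_sumr_eq _ _ _ (fun a => - gold R ^+ a)) //.
  by rewrite opprK addrC.
by move=> a _; rewrite exprS; ring.
Qed.

(** The exact value x^c - x^(Q + 1) of the left side is bounded using x^c <= 1; for c > Q + 1 the
    sum is empty. *)
Lemma sum_gold_le (R : realType) (Q c : nat) :
  (\sum_(c <= a < Q.+1) gold R ^+ a) * gold R ^+ 2 <=
  gold R ^+ c * (1 - gold R ^+ Q.+1).
Proof.
have x0 := gold_gt0 R; have x1 := gold_lt1 R.
have y0 : 0 < gold R ^+ Q.+1 by rewrite exprn_gt0.
have y1 : gold R ^+ Q.+1 < 1 by rewrite exprn_ilt1 // ltW.
have z0 : 0 < gold R ^+ c by rewrite exprn_gt0.
case: (leqP c Q.+1) => [cQ|/ltnW Qc].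
  have z1 : gold R ^+ c <= 1 by rewrite exprn_ile1 // ltW.
  by rewrite sum_gold_from //; nra.
by rewrite big_geq // mul0r; nra.
Qed.

Lemma prod_pow_card (R : realType) (T : finType) (c : R) (A : {set T}) :
  \prod_i c ^+ (i \in A) = c ^+ #|A|.
Proof. by rewrite -expr_sum -sum1_card [in RHS]big_mkcond; congr (_ ^+ _); apply: eq_bigr => i _; case: (i \in A). Qed.

Lemma expr_divn_absorb (R : realType) (a r : R) (n K : nat) :
  0 <= a -> 0 < r -> r < 1 -> a * r ^+ K <= 1 -> a ^+ (n %/ K) * r ^+ n <= 1.
Proof.
move=> a0 r0 r1 h; apply: (@le_trans _ _ ((a * r ^+ K) ^+ (n %/ K))).
  rewrite exprMn ler_wpM2l ?exprn_ge0 // -exprM.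
  by rewrite ler_wiXn2l ?(ltW r0) ?(ltW r1) // mulnC leq_trunc_div.
by rewrite exprn_ile1 // mulr_ge0 // exprn_ge0 // ltW.
Qed.

(* Compare cubes: 4 <= (8/5)^3. *)
Lemma two_thirds (R : realType) (a b : nat) :
  (3 * a <= 2 * b)%N -> 2 ^+ a <= (8 / 5) ^+ b :> R.
Proof.
move=> h; rewrite -(@ler_pXn2r _ 3) ?nnegrE ?exprn_ge0 //; last by lra.
rewrite -!exprM mulnC; apply: (@le_trans _ _ (2 ^+ (2 * b))).
  by rewrite ler_weXn2l // ler1n.
rewrite mulnC !exprM exprAC [leRHS]exprAC lerXn2r ?nnegrE ?exprn_ge0 //; lra.
Qed.

(** * The graph of pairs with sum in P + c *)

Definition sumnbrs (n c : nat) (P : {set 'I_n}) (i : 'I_n) : {set 'I_n} :=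
  [set j : 'I_n | [exists p in P, (i + j == p + c)%N]].

(** The shift c will be 0 for sums without carry and n for sums with a carry. Each p yields the
    single neighbour p + c - i, which the hypothesis keeps in range. *)
Lemma card_sumnbrs (n c : nat) (P : {set 'I_n}) (i : 'I_n) :
  (forall p : 'I_n, p \in P -> (i <= p + c < i + n)%N) -> #|sumnbrs c P i| = #|P|.
Proof.
move=> h; have n0 : (0 < n)%N by apply: leq_ltn_trans (ltn_ord i).
pose f (p : 'I_n) : 'I_n := insubd i (p + c - i)%N.
have fE p : p \in P -> f p = (p + c - i)%N :> nat.
  by move=> /h hp; rewrite val_insubd (_ : (_ < n)%N) //; lia.
rewrite -(card_in_imset (f := f) (D := P)).
  congr #|pred_of_set _|; apply/setP => j; rewrite inE; apply/existsP/imsetP.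
    move=> [p /andP[pP /eqP E]]; exists p => //.
    by apply: val_inj; rewrite /= fE //; lia.
  move=> [p pP ->]; exists p; rewrite pP /= fE //.
  by have := h p pP; lia.
move=> p p' pP p'P E; apply: val_inj; move/(congr1 val): E => /=.
by rewrite !fE //; have := h p pP; have := h p' p'P; lia.
Qed.

Lemma degree_sumnbrs (n c : nat) (P I : {set 'I_n}) (j : 'I_n) :
  (#|[set i in I | j \in sumnbrs c P i]| <= #|P|)%N.
Proof.
pose f (i : 'I_n) : 'I_n := odflt i [pick p in P | (i + j == p + c)%N].
have fP i : j \in sumnbrs c P i -> f i \in P /\ (i + j = f i + c)%N.
  rewrite inE /f => /existsP[p /andP[pP pE]].
  by case: pickP => [q /andP[? /eqP]|/(_ p)] //=; rewrite pP pE.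
rewrite -(card_in_imset (f := f)).
  apply: subset_leq_card; apply/subsetP => q /imsetP[i].
  by rewrite inE => /andP[_ /fP[fi _]] ->.
move=> i i'; rewrite inE => /andP[_ /fP[_ e1]].
rewrite inE => /andP[_ /fP[_ e2]] E.
by apply: val_inj => /=; rewrite E in e1; lia.
Qed.

(** * Words with many letters above 3 *)

(** Every vertex of I has degree |P| = t e, and its neighbours outside I lie in B. Dividing the
    double count by e leaves a bound for the container in which B is the only loss. *)
Lemma sumset_fingerprint (n c t e : nat) (P I B X Y : {set 'I_n}) :
  (0 < e)%N ->
  (forall i p : 'I_n, i \in I -> p \in P -> (i <= p + c < i + n)%N) ->
  (I != set0 -> #|P| = (t * e)%N) ->
  (forall i j p : 'I_n, i \in X -> j \in Y -> p \in P -> (i + j)%N <> (p + c)%N) ->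
  (forall i j p : 'I_n, i \in I -> p \in P -> (i + j = p + c)%N -> j \in I :|: B) ->
  exists F : {set 'I_n}, [/\ (#|F| * e <= n)%N,
    X :&: I \subset few_new (sumnbrs c P) I F e,
    [disjoint nbrs (sumnbrs c P) F & Y] &
    (#|few_new (sumnbrs c P) I F e| * (t - 1) <=
       t * (#|nbrs (sumnbrs c P) F :&: I| + #|B|))%N].
Proof.
move=> e0 hI hP hXY hB; set N := sumnbrs c P.
have hN i j : i \in X -> j \in N i -> j \notin Y.
  move=> iX; rewrite inE => /existsP[p /andP[pP /eqP E]]; apply/negP => jY.
  exact: hXY iX jY pP E.
have [F [FI hF hZ hC]] := fingerprint I e0 hN.
exists F; rewrite card_ord in hF; split => //.
have hdeg j : (#|[set i in I | j \in N i]| <= t * e)%N.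
  (* For empty I the size of P is unknown, but there is nothing to count. *)
  have [I0|/hP <-] := eqVneq I set0; last exact: degree_sumnbrs.
  by rewrite (_ : [set _ in _ | _] = set0) ?cards0 //; apply/setP => i; rewrite !inE I0 inE.
have hNd i : i \in I -> #|N i| = (t * e)%N.
  move=> iI; rewrite -hP; last by apply/set0Pn; exists i.
  by apply: card_sumnbrs => p pP; exact: hI.
have := card_few_new F e hNd hdeg.
have CI : (#|nbrs N F| <= #|nbrs N F :&: I| + #|B|)%N.
  rewrite -(cardsID I (nbrs N F)) leq_add2l; apply: subset_leq_card.
  apply/subsetP => j /setDP[/bigcupP[i iF]]; rewrite inE => /existsP[p /andP[pP /eqP E]].
  move=> jI; have := hB i j p (subsetP FI i iF) pP E.
  by rewrite inE (negbTE jI).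
move: #|few_new _ _ _ _| #|nbrs N F| CI => z y CI hz.
have {}hz : (z * (t - 1) * e <= t * y * e)%N by move: hz; rewrite -{2}(mul1n e) -mulnBl; lia.
rewrite leq_pmul2r // in hz; apply: leq_trans hz _.
by rewrite leq_mul2l CI orbT.
Qed.

Lemma card_ord_interval (n a b : nat) :
  (#|[set i : 'I_n | (a <= i < b)%N]| <= b - a)%N.
Proof.
rewrite cardE -(size_map val) -[leqRHS](size_iota a); apply: uniq_leq_size.
  by rewrite map_inj_uniq ?enum_uniq //; exact: val_inj.
move=> j /mapP[i]; rewrite mem_enum inE mem_iota => hi ->.
by move: hi => /= hi; lia.
Qed.

(** For a container Z, the letter 1 costs most on Z outside C. For large t this set is hardly larger
    than C within I; for every t >= 2 it is at most twice as large as C within I together with B,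
    and disjointness of the two parts of I gives the ratio 2/3. *)
Lemma few_new_sizes (T : finType) (I C Z B : {set T}) (t : nat) :
  (1 < t)%N -> Z \subset I -> (#|Z| * (t - 1) <= t * (#|C :&: I| + #|B|))%N ->
  (#|Z :\: C| <= #|C :&: I| + #|B| + #|T| %/ t)%N /\
  (3 * #|Z :\: C| <= 2 * (#|I| + #|B|))%N.
Proof.
move=> t1 ZI h; have zZ : (#|Z :\: C| <= #|Z|)%N by apply: subset_leq_card; exact: subsetDl.
have ZT : (#|Z| <= #|T|)%N by exact: max_card.
have zI : (#|Z :\: C| + #|C :&: I| <= #|I|)%N.
  rewrite -(cardsID C I) addnC (setIC C) leq_add2l.
  by apply: subset_leq_card; exact: setSD.
move: #|Z :\: C| #|Z| #|C :&: I| #|B| #|I| #|T| h zZ ZT zI => z y c b i n h zZ ZT zI.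
split; last by nia.
apply: (leq_trans zZ); rewrite -leq_subLR leq_divRL; last by lia.
by nia.
Qed.


(** The interval [L, L'[ is the block that contains P. Position 0, with k_0 = 0, belongs neither to
    the head nor to the tail. *)
Definition head_part (n L : nat) := [set i : 'I_n | (0 < i < L)%N].
Definition mid_part (n L L' : nat) := [set i : 'I_n | (L <= i < L')%N].
Definition tail_part (n L' : nat) := [set i : 'I_n | (0 < i)%N && (L' <= i)%N].

Lemma head_tailF (n L L' : nat) (i : 'I_n) : (L <= L')%N ->
  i \in head_part n L -> (i \in tail_part n L') = false.
Proof. by rewrite !inE; lia. Qed.

Lemma card_parts (n L L' w : nat) : (L <= L')%N -> (L' <= L + w)%N ->
  (#|head_part n L| + #|tail_part n L'| +
    #|~: (head_part n L :|: tail_part n L')| = n)%N /\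
  (#|~: (head_part n L :|: tail_part n L')| <= w.+1)%N.
Proof.
move=> LL' Lw; split.
  rewrite -[RHS]card_ord -(cardsC (head_part n L :|: tail_part n L')) cardsU.
  rewrite (_ : head_part n L :&: tail_part n L' = set0) ?cards0 ?subn0 //.
  apply/setP => i; rewrite inE in_set0.
  by case: (boolP (i \in head_part n L)) => //= /(head_tailF LL').
apply: (@leq_trans #|mid_part n L L' :|: mid_part n 0 1|).
  by apply: subset_leq_card; apply/subsetP => i; rewrite !inE negb_or; lia.
apply: leq_trans (leq_card_setU _ _) _; rewrite -(addn1 w); apply: leq_add.
  by apply: leq_trans (card_ord_interval _ _ _) _; rewrite leq_subLR.
exact: card_ord_interval.
Qed.

Lemma block_bounds (b w : nat) : (b.-1 * w <= b * w <= b.-1 * w + w)%N.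
Proof. by case: b => [|b] //=; rewrite mulSn; lia. Qed.

(* A word satisfies dense_lower <= letter <= dense_upper once the positions Ex and the
   fingerprints F1 (of sums p in P) and F2 (of sums p + n) are known. *)
Definition dense_lower (n e L L' : nat) (P F1 F2 Ex : {set 'I_n}) (i : 'I_n) : nat :=
  if i \in Ex then 0 else
  if i \in head_part n L then
    if i \in nbrs (sumnbrs 0 P) F1 then 3 else
    if i \in few_new (sumnbrs 0 P) (head_part n L) F1 e then 1 else 2
  else if i \in tail_part n L' then
    if i \in few_new (sumnbrs n P) (tail_part n L') F2 e :\: nbrs (sumnbrs n P) F2
    then 1 else 2
  else 1.

(** Letters above 3 behind the chosen block are few, and [Ex] collects them; the rest of the tail is
    thus capped at 3. *)
Definition dense_upper (n Q L' : nat) (Ex : {set 'I_n}) (i : 'I_n) : nat :=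
  if i \in Ex then Q else if i \in tail_part n L' then 3 else Q.

(** These conditions do not mention the word, so they can define the finite set of labels in the
    union bound. *)
Definition fingerprint_ok (n c t e L L' : nat) (I P F : {set 'I_n}) : bool :=
  (#|F| * e <= n)%N && (#|few_new (sumnbrs c P) I F e| * (t - 1) <=
     t * (#|nbrs (sumnbrs c P) F :&: I| + #|mid_part n L L'|))%N.

(** For i in ]0, L[ and p in [L, L'[ the difference p - i lies in ]0, L'[, that is, in the head or
    in the block. *)
Lemma head_fingerprint (n t e L L' : nat) (P X Y : {set 'I_n}) :
  (0 < e)%N -> (L <= L')%N -> ((0 < L)%N -> #|P| = (t * e)%N) ->
  (forall p : 'I_n, p \in P -> (L <= p < L')%N) ->
  (forall i j p : 'I_n, i \in X -> j \in Y -> p \in P -> (i + j)%N <> p) ->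
  exists F : {set 'I_n}, [/\ fingerprint_ok 0 t e L L' (head_part n L) P F,
    X :&: head_part n L \subset few_new (sumnbrs 0 P) (head_part n L) F e &
    [disjoint nbrs (sumnbrs 0 P) F & Y]].
Proof.
move=> e0 LL' hP PL hXY.
have [||||F [h1 h2 h3 h4]] := @sumset_fingerprint n 0 t e P (head_part n L)
  (mid_part n L L') X Y e0.
- by move=> i p; rewrite inE => hi /PL; have := ltn_ord p; lia.
- by case/set0Pn => i; rewrite inE => hi; apply: hP; lia.
- by move=> i j p iX jY pP; rewrite addn0; exact: hXY.
- by move=> i j p; rewrite !inE => hi /PL; lia.
by exists F; split => //; apply/andP.
Qed.

(** For i in [L', n[ and p in [L, L'[ the number p + n - i lies in ]p, n[, that is, in the block or
    in the tail. *)
Lemma tail_fingerprint (n t e L L' : nat) (P X Y : {set 'I_n}) :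
  (0 < e)%N -> (L <= L')%N -> #|P| = (t * e)%N ->
  (forall p : 'I_n, p \in P -> (L <= p < L')%N) ->
  (forall i j p : 'I_n, i \in X -> j \in Y -> p \in P -> (i + j)%N <> (p + n)%N) ->
  exists F : {set 'I_n}, [/\ fingerprint_ok n t e L L' (tail_part n L') P F,
    X :&: tail_part n L' \subset few_new (sumnbrs n P) (tail_part n L') F e &
    [disjoint nbrs (sumnbrs n P) F & Y]].
Proof.
move=> e0 LL' hP PL hXY.
have [||||F [h1 h2 h3 h4]] := @sumset_fingerprint n n t e P (tail_part n L')
  (mid_part n L L') X Y e0.
- by move=> i p; rewrite inE => hi /PL; have := ltn_ord i; lia.
- by [].
- exact: hXY.
- by move=> i j p; rewrite !inE => hi /PL; have := ltn_ord i; lia.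
by exists F; split => //; apply/andP.
Qed.

Lemma dense_cover (n Q K t e : nat) (k : {ffun 'I_n -> 'I_Q.+1}) :
  (0 < K)%N -> (0 < e)%N ->
  (forall i : 'I_n, (0 < i)%N -> (0 < k i)%N) ->
  (forall i j l : 'I_n, (i + j = l)%N -> (k l <= k i + k j)%N) ->
  (forall i j l : 'I_n, (i + j = l + n)%N -> (k l <= (k i + k j).+1)%N) ->
  (K * (t * e) < #|[set i | (3 < k i)%N]|)%N ->
  exists b : nat, exists P F1 F2 Ex : {set 'I_n},
    let L := (b.-1 * (n %/ K).+1)%N in let L' := (b * (n %/ K).+1)%N in
    [/\ (b <= K)%N,
        [/\ (#|P| <= t * e)%N, fingerprint_ok 0 t e L L' (head_part n L) P F1,
        fingerprint_ok n t e L L' (tail_part n L') P F2 &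
        (#|Ex| <= (K * (t * e)).+1)%N] &
        forall i, (dense_lower e L L' P F1 F2 Ex i <= k i <= dense_upper Q L' Ex i)%N].
Proof.
move=> K0 e0 kpos ksub kcarry kbig; set E := [set i | (3 < k i)%N] in kbig.
have [b [bK Etail hP]] := last_dense_block (t * e) E K0.
set w := (n %/ K).+1 in Etail hP *.
(* For b = 0 the whole of E would have at most K t e elements. *)
have b0 : (0 < b)%N.
  rewrite lt0n; apply: contraTneq kbig => b0; rewrite -leqNgt.
  apply: leq_trans Etail; apply: subset_leq_card; apply/subsetP => i.
  by rewrite b0 => iE; rewrite inE iE.
have {hP} [P [/subsetP PE Pc Pb]] := hP b0.
have /andP[LL' _] := block_bounds b w.
have Pk p : p \in P -> (3 < k p)%N by move=> /PE; rewrite inE.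
(* Since 4 <= k_p <= k_i + k_j, a letter 1 is never opposite a letter at most 2; neighbours of the
   fingerprint therefore carry at least 3. *)
have [F1 [F1s F1Z F1C]] : exists F : {set 'I_n},
    [/\ fingerprint_ok 0 t e (b.-1 * w) (b * w) (head_part n (b.-1 * w)) P F,
    [set i | (k i <= 1)%N] :&: head_part n (b.-1 * w) \subset
      few_new (sumnbrs 0 P) (head_part n (b.-1 * w)) F e &
    [disjoint nbrs (sumnbrs 0 P) F & [set i | (k i <= 2)%N]]].
  apply: head_fingerprint => // i j p; rewrite !inE => hi hj /Pk hp E0.
  by have := ksub i j p E0; lia.
(* The carry weakens this to k_i + k_j >= 3, which excludes only pairs of 1's. *)
have [F2 [F2s F2Z F2C]] : exists F : {set 'I_n},
    [/\ fingerprint_ok n t e (b.-1 * w) (b * w) (tail_part n (b * w)) P F,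
    [set i | (k i <= 1)%N] :&: tail_part n (b * w) \subset
      few_new (sumnbrs n P) (tail_part n (b * w)) F e &
    [disjoint nbrs (sumnbrs n P) F & [set i | (k i <= 1)%N]]].
  apply: tail_fingerprint => // i j p; rewrite !inE => hi hj /Pk hp E0.
  by have := kcarry i j p E0; lia.
pose Ex := [set i in E | (b * w <= i)%N] :|: mid_part n 0 1.
exists b, P, F1, F2, Ex; split => //.
  split => //; first by rewrite Pc.
  apply: leq_trans (leq_card_setU _ _) _; rewrite -(addn1 (K * _)); apply: leq_add => //.
  exact: card_ord_interval.
move=> i; have ki : (k i <= Q)%N by rewrite -ltnS.
rewrite /dense_lower /dense_upper; case: ifP => [_|/negbT iEx]; first by rewrite leq0n.
have i0 : (0 < i)%N.
  by rewrite lt0n; apply: contraNneq iEx => h0; rewrite !inE h0 orbT.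
have kp := kpos i i0.
case: ifP => iI1.
  rewrite (head_tailF LL' iI1) ki andbT; case: ifP => iC.
    by have := disjointFr F1C iC; rewrite inE => /negbT; rewrite -ltnNge.
  case: ifP => // /negbT iZ; rewrite ltnNge; apply: contraNN iZ => k1.
  by move/subsetP: F1Z => /(_ i); rewrite inE iI1 inE k1 => /(_ isT).
case: ifP => iI2; last by rewrite kp.
have k3 : (k i <= 3)%N.
  move: iEx iI2; rewrite !inE negb_or /= => /andP[h _] /andP[_ h'].
  by move: h; rewrite h' andbT -leqNgt.
rewrite k3 andbT; case: ifP => // /negbT; rewrite inE negb_and negbK => iZ.
rewrite ltnNge; apply/negP => k1; case/orP: iZ => [iC|].
  by have := disjointFr F2C iC; rewrite inE k1.
by move/subsetP: F2Z => /(_ i); rewrite inE iI2 inE k1 => /(_ isT) ->.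
Qed.

(** All letters from 2 on have total weight exactly 1. Capping the letters at Q pushes this below 1,
    and [theta] is a bound for the resulting factor that serves every starting letter. *)
Definition theta (R : realType) (Q : nat) : R := 1 - gold R ^+ Q.+1.

Lemma theta_bounds (R : realType) (Q : nat) : gold R ^+ 2 <= theta R Q < 1.
Proof.
have x0 := gold_gt0 R; have x1 := gold_lt1 R; rewrite /theta.
apply/andP; split; last by rewrite gtrBl exprn_gt0.
by rewrite goldE lerD2l lerN2 exprS ler_piMr ?(ltW x0) // exprn_ile1 // ltW.
Qed.

Lemma sum_gold_theta (R : realType) (Q c : nat) :
  \sum_(c <= a < Q.+1) gold R ^+ a <= gold R ^+ c * theta R Q / gold R ^+ 2.
Proof. by rewrite ler_pdivlMr ?exprn_gt0 ?gold_gt0 //; exact: sum_gold_le. Qed.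

Lemma sum_gold13 (R : realType) : \sum_(1 <= a < 4) gold R ^+ a = gold R * 2.
Proof.
have x2 := goldE R; rewrite expr2 in x2.
by rewrite /index_iota /= !big_cons big_nil !exprS expr0; nra.
Qed.

Lemma sum_gold23 (R : realType) : \sum_(2 <= a < 4) gold R ^+ a = gold R.
Proof.
have x2 := goldE R; rewrite expr2 in x2.
by rewrite /index_iota /= !big_cons big_nil !exprS expr0; nra.
Qed.

Lemma few_newF (T : finType) (N : T -> {set T}) (I F C : {set T}) (e : nat) (i : T) :
  (i \in I) = false -> (i \in few_new N I F e :\: C) = false.
Proof. by move=> h; rewrite !inE h andbF. Qed.

(** Each factor depends on membership in one set, so the product over all positions consists of
    powers with cardinalities as exponents. On [Ex] the other factors together are at least x^4, and
    x^(-6) raises this to x^(-2), which bounds the total weight of all letters. *)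
Definition dense_weight (R : realType) (n Q e L L' : nat) (P F1 F2 Ex : {set 'I_n}) (i : 'I_n) : R :=
  theta R Q ^+ (i \in head_part n L) *
  gold R ^+ (i \in nbrs (sumnbrs 0 P) F1 :&: head_part n L) *
  (gold R)^-1 ^+ (i \in few_new (sumnbrs 0 P) (head_part n L) F1 e :\:
                        nbrs (sumnbrs 0 P) F1) *
  gold R ^+ (i \in tail_part n L') *
  2 ^+ (i \in few_new (sumnbrs n P) (tail_part n L') F2 e :\:
              nbrs (sumnbrs n P) F2) *
  (gold R)^-1 ^+ (i \in ~: (head_part n L :|: tail_part n L')) *
  (gold R ^- 6) ^+ (i \in Ex).

Lemma dense_letters_le (R : realType) (n Q e L L' : nat) (P F1 F2 Ex : {set 'I_n}) (i : 'I_n) :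
  (L <= L')%N ->
  \sum_(a < Q.+1) (dense_lower e L L' P F1 F2 Ex i <= a <= dense_upper Q L' Ex i)%N%:R * gold R ^+ a
    <= dense_weight R Q e L L' P F1 F2 Ex i.
Proof.
move=> LL'; have x0 := gold_gt0 R; have x1 := gold_lt1 R.
have /andP[th0 th1] := theta_bounds R Q.
have y0 : 0 < (gold R)^-1 by rewrite invr_gt0.
have y1 : 1 <= (gold R)^-1 by rewrite invf_ge1 // ltW.
have x0' : gold R != 0 by rewrite gt_eqF.
apply: le_trans (@sum_letters_le R Q _ _ (fun a => gold R ^+ a) _) _.
  by move=> a; rewrite exprn_ge0 // ltW.
rewrite /dense_lower /dense_upper /dense_weight; case: ifP => iEx.
  apply: le_trans (sum_gold_theta _ _ _) _; rewrite expr0 mul1r expr1.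
  set x := gold R in x0 x1 y0 y1 x0' th0 *.
  have bitx (u : bool) : x <= x ^+ u by case: u; rewrite /= ?expr0 ?expr1 ?lexx ?ltW.
  have bity (u : bool) : 1 <= x^-1 ^+ u by case: u; rewrite /= ?expr0 ?expr1 ?lexx.
  have bit2 (u : bool) : 1 <= 2 ^+ u :> R by case: u; rewrite /= ?expr0 ?expr1 ?lexx ?ler1n.
  have bitt (u : bool) : x ^+ 2 <= theta R Q ^+ u.
    by case: u; rewrite /= ?expr0 ?expr1 // exprn_ile1 // ltW.
  apply: (@le_trans _ _ (x ^+ 2 * x * 1 * x * 1 * 1 * x ^- 6)).
    rewrite !mulr1 (_ : _ * x ^- 6 = x ^- 2); last by field.
    by rewrite ler_piMl ?(ltW th1) // invr_ge0 exprn_ge0 // ltW.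
  have x6 : 0 <= x ^- 6 by rewrite invr_ge0 exprn_ge0 // ltW.
  have [p1 p2] : 0 <= x ^+ 2 /\ 0 <= x by rewrite exprn_ge0 ltW.
  do 6 (apply: ler_pM; [by rewrite ?mulr1 ?(mulr_ge0 (mulr_ge0 p1 p2) p2) ?(mulr_ge0 p1 p2)|by rewrite ?ler01| |by []]).
  exact: bitt.
rewrite expr0 mulr1 in_setC in_setU.
case: ifP => iI1.
  rewrite (head_tailF LL' iI1) (few_newF _ _ _ _ (head_tailF LL' iI1)).
  rewrite in_setI in_setD iI1 andbT !expr0 expr1 !mulr1.
  case: ifP => iC /=; first last.
    case: ifP => iZ /=; rewrite ?expr0 ?expr1 mulr1; apply: le_trans (sum_gold_theta _ _ _) _.
      by rewrite expr1 (_ : _ / _ = theta R Q / gold R) //; field.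
    by rewrite (_ : _ / _ = theta R Q) ?mulr1 //; field.
  rewrite expr0 mulr1 expr1; apply: le_trans (sum_gold_theta _ _ _) _.
  by rewrite (_ : _ / _ = theta R Q * gold R) //; field.
rewrite (few_newF _ _ _ _ iI1) in_setI iI1 andbF /= !expr0 !mul1r.
case: ifP => iI2 /=; rewrite ?expr0 ?expr1 ?mulr1.
  by case: ifP => iZ; rewrite ?expr0 ?expr1 ?sum_gold13 ?sum_gold23 ?mulr1.
rewrite (few_newF _ _ _ _ iI2) expr0 !mul1r.
apply: le_trans (sum_gold_theta _ _ 1) _; rewrite expr1.
rewrite (_ : _ / _ = theta R Q / gold R); last by field.
by rewrite ler_piMl ?(ltW y0) ?(ltW th1).
Qed.

(** In the head, of size a1, the gain x^c cancels the loss x^(-z1) up to w + m positions. In the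
    tail, of size a2, the powers of 2 cost at most 8/5 per position. So each position of head and
    tail has weight at most g, and the remaining losses are exponential in w and m only. *)
Lemma dense_weight_prod_le (R : realType) (x th g : R) (n w a1 a2 u ex D c z1 z2 m : nat) :
  0 < x -> x < 1 -> 0 < th -> th <= g -> x * (8 / 5) <= g -> g < 1 ->
  (z1 <= c + w + m)%N -> 2 ^+ z2 <= (8 / 5) ^+ (a2 + w) :> R ->
  (a1 + a2 + u = n)%N -> (u <= w.+1)%N -> (ex <= D)%N ->
  th ^+ a1 * x ^+ c * x^-1 ^+ z1 * x ^+ a2 * 2 ^+ z2 * x^-1 ^+ u * (x ^- 6) ^+ ex
  <= (x ^- 6) ^+ D * x^-1 * g^-1 * (x ^- 2 * (8 / 5) / g) ^+ w * x^-1 ^+ m * g ^+ n.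
Proof.
move=> x0 x1 th0 thg xg g1 hz1 hz2 hn hu hex.
have g0 : 0 < g by apply: lt_le_trans thg.
have y1 : 1 <= x^-1 by rewrite invf_ge1 // ltW.
have gi1 : 1 <= g^-1 by rewrite invf_ge1 // ltW.
have y0 : 0 < x^-1 by rewrite invr_gt0.
have gi0 : 0 < g^-1 by rewrite invr_gt0.
have p0 y k : 0 < y -> 0 <= y ^+ k :> R by move=> ?; rewrite exprn_ge0 // ltW.
have x6 : 1 <= x ^- 6 by rewrite invf_ge1 ?exprn_gt0 // exprn_ile1 // ltW.
have x60 : 0 < x ^- 6 by rewrite invr_gt0 exprn_gt0.
have e85 : 0 < 8 / 5 :> R by lra.
have s1 : x ^+ c * x^-1 ^+ z1 <= x^-1 ^+ w * x^-1 ^+ m.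
  rewrite -exprD; apply: (@le_trans _ _ (x ^+ c * x^-1 ^+ (c + w + m))).
    by rewrite ler_wpM2l ?p0 // ler_weXn2l.
  by rewrite -addnA exprD mulrA -exprMn mulfV ?gt_eqF // expr1n mul1r.
have s2 : x ^+ a2 * 2 ^+ z2 <= (x * (8 / 5)) ^+ a2 * (8 / 5) ^+ w.
  by rewrite exprMn -mulrA -exprD ler_wpM2l ?p0.
have s3 : x^-1 ^+ u <= x^-1 ^+ w * x^-1 by rewrite -exprSr ler_weXn2l.
have s4 : (x ^- 6) ^+ ex <= (x ^- 6) ^+ D by rewrite ler_weXn2l.
have s5 : th ^+ a1 * (x * (8 / 5)) ^+ a2 <= g^-1 ^+ w * g^-1 * g ^+ n.
  apply: (@le_trans _ _ (g ^+ a1 * g ^+ a2)).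
    have xe0 : 0 < x * (8 / 5) by rewrite mulr_gt0.
    apply: ler_pM; [exact: p0|exact: p0| |].
      by rewrite lerXn2r // nnegrE ltW.
    by rewrite lerXn2r // nnegrE ltW.
  rewrite -hn !exprD -exprSr -[leLHS]mul1r -[leRHS]mulrCA mulrC.
  apply: ler_wpM2l; first by rewrite mulr_ge0 ?p0.
  apply: (@le_trans _ _ (g^-1 ^+ u * g ^+ u)).
    by rewrite -exprMn mulVf ?gt_eqF // expr1n.
  by rewrite ler_wpM2r ?p0 // ler_weXn2l.
have -> : th ^+ a1 * x ^+ c * x^-1 ^+ z1 * x ^+ a2 * 2 ^+ z2 * x^-1 ^+ u * (x ^- 6) ^+ ex
  = th ^+ a1 * (x ^+ a2 * 2 ^+ z2) * (x ^+ c * x^-1 ^+ z1) * x^-1 ^+ u * (x ^- 6) ^+ ex.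
  by ring.
apply: (@le_trans _ _ (th ^+ a1 * ((x * (8 / 5)) ^+ a2 * (8 / 5) ^+ w) *
  (x^-1 ^+ w * x^-1 ^+ m) * (x^-1 ^+ w * x^-1) * (x ^- 6) ^+ D)).
  by do !(apply: ler_pM => //; rewrite ?mulr_ge0 ?p0 //).
pose rest := (8 / 5) ^+ w * (x^-1 ^+ w * x^-1 ^+ m) * (x^-1 ^+ w * x^-1) * (x ^- 6) ^+ D.
have rest0 : 0 <= rest by rewrite /rest !mulr_ge0 ?p0 // ltW.
apply: (@le_trans _ _ ((g^-1 ^+ w * g^-1 * g ^+ n) * rest)).
  apply: le_trans (ler_wpM2r rest0 s5).
  by rewrite le_eqVlt; apply/orP; left; apply/eqP; rewrite /rest; ring.
have -> : (x ^- 2 * (8 / 5) / g) ^+ w = x^-1 ^+ w * x^-1 ^+ w * (8 / 5) ^+ w * g^-1 ^+ w.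
  by rewrite -!exprMn; congr (_ ^+ _); rewrite -exprVn expr2.
by rewrite le_eqVlt; apply/orP; left; apply/eqP; rewrite /rest; ring.
Qed.

(** More than D letters above 3 force a dense block; [dense_cover] then confines the word to one of
    few boxes, and each box has exponentially small weight. *)
Lemma many_large_letters (R : realType) (Q : nat) :
  exists D : nat, exists C r : R, [/\ 0 <= C, 0 < r, r < 1 &
  forall (n : nat) (A : pred {ffun 'I_n -> 'I_Q.+1}),
  (forall k : {ffun 'I_n -> 'I_Q.+1}, A k ->
    [/\ forall i : 'I_n, (0 < i)%N -> (0 < k i)%N,
        forall i j l : 'I_n, (i + j = l)%N -> (k l <= k i + k j)%N,
        forall i j l : 'I_n, (i + j = l + n)%N -> (k l <= (k i + k j).+1)%N &
        (D < #|[set i | (3 < k i)%N]|)%N]) ->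
  \sum_(k | A k) \prod_i gold R ^+ k i <= C * r ^+ n].
Proof.
have x0 := gold_gt0 R; have x1 := gold_lt1 R.
have /andP[_ xu] := gold_bounds R.
have /andP[th0 th1] := theta_bounds R Q.
have y0 : 0 < (gold R)^-1 by rewrite invr_gt0.
pose g : R := Num.max (theta R Q) (gold R * (8 / 5)).
have g1 : g < 1 by rewrite gt_max th1; lra.
have gth : theta R Q <= g by rewrite le_max lexx.
have gbe : gold R * (8 / 5) <= g by rewrite le_max lexx orbT.
have g0 : 0 < g by apply: lt_le_trans gbe; lra.
(* Of the seven factors r^n four pay for the choices of P, F1, F2 and Ex, one for the block length
   w, one for x^(-n/t), and one remains. *)
have [r [r0 r1 gr]] := root_above 7 g0 g1.
pose a0 : R := gold R ^- 2 * (8 / 5) / g.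
have a00 : 0 <= a0.
  apply: divr_ge0; last exact: ltW.
  by apply: mulr_ge0; [rewrite invr_ge0 exprn_ge0 // ltW | lra].
have [K' hK'] := expr_absorb a0 r0 r1.
have [t' ht'] := expr_absorb (gold R)^-1 r0 r1.
have hK : a0 * r ^+ K'.+1 <= 1.
  by apply: le_trans hK'; rewrite ler_wpM2l // exprS ler_piMl ?exprn_ge0 // ltW.
have ht : (gold R)^-1 * r ^+ t'.+2 <= 1.
  apply: le_trans ht'; rewrite ler_wpM2l ?(ltW y0) // -addn2 exprD.
  by rewrite ler_piMr ?exprn_ge0 ?exprn_ile1 // ltW.
move: K'.+1 (ltn0Sn K') hK => K K0 hK.
move: t'.+2 (isT : (1 < t'.+2)%N) ht => t t1 ht.
have [e e0 he] := sparse_subsets r0 r1.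
have [C1 C10 hC1] := few_subsets (t * e) r0 r1.
have [C2 C20 hC2] := few_subsets (K * (t * e)).+1 r0 r1.
pose c0 : R := (gold R ^- 6) ^+ (K * (t * e)).+1 * (gold R)^-1 * g^-1.
have c00 : 0 <= c0.
  by rewrite /c0 !mulr_ge0 ?exprn_ge0 ?invr_ge0 ?exprn_ge0 // ltW.
(* Fewer than t e large letters in each of K blocks is what this threshold rules out. *)
exists (K * (t * e))%N, (K.+1%:R * C1 * C2 * (c0 * a0)), r; split => //.
  by apply: mulr_ge0; [rewrite !mulr_ge0 | exact: mulr_ge0 c00 a00].
move=> n A hA; pose w := (n %/ K).+1.
pose T : finType := ('I_K.+1 * {set 'I_n} * {set 'I_n} * {set 'I_n} * {set 'I_n})%type.
pose L (b : 'I_K.+1) := (b.-1 * w)%N.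
pose L' (b : 'I_K.+1) := (b * w)%N.
pose q (d : T) (i : 'I_n) (a : 'I_Q.+1) : R := let: (b, P, F1, F2, Ex) := d in
  (dense_lower e (L b) (L' b) P F1 F2 Ex i <= a <= dense_upper Q (L' b) Ex i)%N%:R * gold R ^+ a.
pose ok (d : T) := let: (b, P, F1, F2, Ex) := d in
  [&& (#|P| <= t * e)%N, fingerprint_ok 0 t e (L b) (L' b) (head_part n (L b)) P F1,
   fingerprint_ok n t e (L b) (L' b) (tail_part n (L' b)) P F2 &
   (#|Ex| <= (K * (t * e)).+1)%N].
pose M : R := c0 * a0 ^+ w * (gold R)^-1 ^+ (n %/ t) * g ^+ n.
apply: (@le_trans _ _ (#|[set d | ok d]|%:R * M)).
  apply: (@sum_words_cover _ _ _ T A _ _ q) => [[[[[b P] F1] F2] Ex] i a|k Ak|d].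
  - by rewrite /q mulr_ge0 // exprn_ge0 // ltW.
  - have [kpos ksub kcarry kbig] := hA k Ak.
    have [b [P [F1 [F2 [Ex [bK [P1 P2 P3 P4] hbox]]]]]] :=
      dense_cover K0 e0 kpos ksub kcarry kbig.
    have bK1 : (b < K.+1)%N by [].
    exists (Ordinal bK1, P, F1, F2, Ex).
      by rewrite inE /= /L /L' /= P1 P2 P3 P4.
    by apply: ler_prod => i _; rewrite exprn_ge0 ?(ltW x0) //= /L /L' /= hbox mul1r.
  - rewrite inE; case: d => [[[[b P] F1] F2] Ex] /and4P[_ /andP[_ s1] /andP[_ s2] hEx].
    have /andP[LL' Lw] := block_bounds b w; rewrite -/(L b) -/(L' b) in LL' Lw.
    apply: (@le_trans _ _ (\prod_i dense_weight R Q e (L b) (L' b) P F1 F2 Ex i)).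
      apply: ler_prod => i _; rewrite dense_letters_le // andbT.
      by apply: sumr_ge0 => a _; rewrite mulr_ge0 // exprn_ge0 // ltW.
    rewrite /dense_weight !big_split /= !prod_pow_card.
    have ZI c I F : few_new (sumnbrs c P) I F e \subset I.
      by apply/subsetP => i; rewrite inE => /andP[].
    have hm : (#|mid_part n (L b) (L' b)| <= w)%N.
      by apply: leq_trans (card_ord_interval _ _ _) _; rewrite leq_subLR.
    have [{}s1 _] := few_new_sizes t1 (ZI _ _ _) s1.
    have [_ {}s2] := few_new_sizes t1 (ZI _ _ _) s2.
    have [hn hu] := @card_parts n (L b) (L' b) w LL' Lw.
    rewrite card_ord in s1.
    apply: dense_weight_prod_le => //; first by apply: lt_le_trans th0; rewrite exprn_gt0.
    + by apply: leq_trans s1 _; rewrite leq_add2r leq_add2l.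
    + apply: two_thirds; apply: leq_trans s2 _.
      by rewrite leq_mul2l leq_add2l.
have rn0 : 0 <= r ^+ n by rewrite exprn_ge0 // ltW.
have cardok : #|[set d | ok d]|%:R * (r ^+ n) ^+ 4 <= K.+1%:R * C1 * C2.
  pose SP := [set F : {set 'I_n} | (#|F| <= t * e)%N].
  pose SF := [set F : {set 'I_n} | (#|F| * e <= n)%N].
  pose SE := [set F : {set 'I_n} | (#|F| <= (K * (t * e)).+1)%N].
  apply: (@le_trans _ _ (#|setX (setX (setX (setX [set: 'I_K.+1] SP) SF) SF) SE|%:R
     * (r ^+ n) ^+ 4)).
    apply: ler_wpM2r; first exact: exprn_ge0.
    rewrite ler_nat; apply: subset_leq_card; apply/subsetP.
    move=> [[[[b P] F1] F2] Ex]; rewrite !inE /= => /and4P[-> /andP[-> _] /andP[-> _] ->].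
    by [].
  rewrite !cardsX cardsT card_ord !natrM.
  have -> : K.+1%:R * #|SP|%:R * #|SF|%:R * #|SF|%:R * #|SE|%:R * (r ^+ n) ^+ 4 =
    K.+1%:R * (#|SP|%:R * r ^+ n) * (#|SE|%:R * r ^+ n) *
     ((#|SF|%:R * r ^+ n) * (#|SF|%:R * r ^+ n)) by ring.
  have hf : #|SF|%:R * r ^+ n <= 1 by exact: he.
  rewrite -[leRHS]mulr1; apply: ler_pM.
  - by rewrite !mulr_ge0.
  - by rewrite !mulr_ge0.
  - apply: ler_pM; rewrite ?mulr_ge0 ?ler0n // ?hC2 //.
    by rewrite ler_wpM2l ?hC1.
  - by rewrite -[leRHS]mulr1; apply: ler_pM; rewrite ?mulr_ge0.
have hw : a0 ^+ w * r ^+ n <= a0.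
  rewrite /w exprS -mulrA ler_piMr //; exact: expr_divn_absorb.
have htn : (gold R)^-1 ^+ (n %/ t) * r ^+ n <= 1.
  by apply: expr_divn_absorb => //; exact: ltW.
have hg : g ^+ n <= (r ^+ n) ^+ 7.
  by rewrite exprAC lerXn2r // nnegrE ?exprn_ge0 // ltW.
have u0 : 0 <= (gold R)^-1 ^+ (n %/ t) by rewrite exprn_ge0 // ltW.
have a0w : 0 <= a0 ^+ w by rewrite exprn_ge0.
apply: (@le_trans _ _ ((#|[set d | ok d]|%:R * (r ^+ n) ^+ 4) *
   (c0 * (a0 ^+ w * r ^+ n)) * (((gold R)^-1 ^+ (n %/ t) * r ^+ n) * r ^+ n))).
  rewrite /M; move: (a0 ^+ w) ((gold R)^-1 ^+ _) a0w u0 => u v u0 v0.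
  apply: (@le_trans _ _ (#|[set d | ok d]|%:R * (c0 * u * v * (r ^+ n) ^+ 7))).
    apply: ler_wpM2l; first exact: ler0n.
    exact: ler_wpM2l (mulr_ge0 (mulr_ge0 c00 u0) v0) _ _ hg.
  by rewrite le_eqVlt; apply/orP; left; apply/eqP; ring.
have hw0 := mulr_ge0 a0w rn0.
have ho : 0 <= #|[set d | ok d]|%:R * (r ^+ n) ^+ 4 :> R.
  by apply: mulr_ge0; [exact: ler0n | exact: exprn_ge0].
apply: ler_pM.
- exact: mulr_ge0 ho (mulr_ge0 c00 hw0).
- by rewrite !mulr_ge0.
- by apply: ler_pM => //; [exact: mulr_ge0 c00 hw0 | exact: ler_wpM2l].
- by rewrite -[leRHS]mul1r; apply: ler_wpM2r.
Qed.

(** * Words with few letters above 3 *)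

Lemma card_ord_interval_ge (n a b : nat) : (b <= n)%N ->
  (b - a <= #|mid_part n a b|)%N.
Proof.
move=> bn; rewrite -[leqLHS](size_iota a) cardE.
rewrite -(size_map val (enum (mid_part n a b))).
apply: uniq_leq_size; first exact: iota_uniq.
move=> i; rewrite mem_iota => hi; have ilt : (i < n)%N by lia.
by apply/mapP; exists (Ordinal ilt); rewrite // mem_enum inE /=; lia.
Qed.

(** The interval [a, s - a], which the reflection of i to s - i preserves. *)
Definition mirror_part (n a s : nat) := [set i : 'I_n | (a <= i)%N && (i + a <= s)%N].

Lemma card_mirror_part (n u s L' : nat) : (s < u + n)%N ->
  (s.+1 - 2 * u - 2 * L' <= #|mirror_part n (maxn u L') s|)%N.
Proof.
move=> sn; case: (leqP (2 * maxn u L') s.+1) => h; last by lia.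
have -> : mirror_part n (maxn u L') s = mid_part n (maxn u L') (s.+1 - maxn u L').
  by apply/setP => i; rewrite !inE; lia.
apply: leq_trans (card_ord_interval_ge _ _); lia.
Qed.

(** Now P carries letters at least 3, and [Ex] takes all letters above 3 as well as the few letters
    3 behind the block, where only 1 and 2 are left. *)
Definition scarce_lower (n e L : nat) (P F Ex : {set 'I_n}) (i : 'I_n) : nat :=
  if i \in Ex then 0 else
  if i \in head_part n L then
    if i \in few_new (sumnbrs 0 P) (head_part n L) F e :\: nbrs (sumnbrs 0 P) F
    then 1 else 2
  else 1.

Definition scarce_upper (n Q L L' : nat) (Ex : {set 'I_n}) (i : 'I_n) : nat :=
  if i \in Ex then Q else if i \in head_part n L then 3 else
  if i \in mid_part n L L' then Q else 2.

Lemma scarce_cover (n Q K t e D : nat) (k : {ffun 'I_n -> 'I_Q.+1}) :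
  (0 < K)%N -> (0 < e)%N -> (0 < t)%N ->
  (forall i : 'I_n, (0 < i)%N -> (0 < k i)%N) ->
  (forall i j l : 'I_n, (i + j = l)%N -> (k l <= k i + k j)%N) ->
  (#|[set i | (3 < k i)%N]| <= D)%N ->
  exists b : nat, exists P F Ex : {set 'I_n},
    let L := (b.-1 * (n %/ K).+1)%N in let L' := (b * (n %/ K).+1)%N in
    [/\ (b <= K)%N && (L <= n)%N,
        [/\ (#|P| <= t * e)%N, fingerprint_ok 0 t e L L' (head_part n L) P F &
        (#|Ex| <= (K * (t * e) + D).+1)%N] &
        forall i, (scarce_lower e L P F Ex i <= k i <= scarce_upper Q L L' Ex i)%N].
Proof.
move=> K0 e0 t0 kpos ksub kbig; set E := [set i | (2 < k i)%N].
have [b [bK Etail hP]] := last_dense_block (t * e) E K0.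
set w := (n %/ K).+1 in Etail hP *.
have /andP[LL' _] := block_bounds b w.
have [P [PE Pc Pb Pc' Ln]] : exists P : {set 'I_n}, [/\ P \subset E,
    (0 < b.-1 * w)%N -> #|P| = (t * e)%N,
    forall p : 'I_n, p \in P -> (b.-1 * w <= p < b * w)%N,
    (#|P| <= t * e)%N & (b.-1 * w <= n)%N].
  (* If no block is dense then b = 0, the head is empty and the empty P serves. *)
  case: (posnP b) => [->|/hP[P [h1 h2 h3]]].
    by exists set0; rewrite sub0set cards0; split => // p; rewrite inE.
  exists P; rewrite h2; split => //.
  have /set0Pn[p /h3/andP[hp _]] : P != set0 by rewrite -card_gt0 h2 muln_gt0 t0.
  exact: leq_trans hp (ltnW (ltn_ord p)).
have Pk p : p \in P -> (2 < k p)%N by move=> /(subsetP PE); rewrite inE.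
have [F [Fs FZ FC]] : exists F : {set 'I_n},
    [/\ fingerprint_ok 0 t e (b.-1 * w) (b * w) (head_part n (b.-1 * w)) P F,
    [set i | (k i <= 1)%N] :&: head_part n (b.-1 * w) \subset
      few_new (sumnbrs 0 P) (head_part n (b.-1 * w)) F e &
    [disjoint nbrs (sumnbrs 0 P) F & [set i | (k i <= 1)%N]]].
  apply: head_fingerprint => // i j p; rewrite !inE => hi hj /Pk hp E0.
  by have := ksub i j p E0; lia.
pose Ex := [set i in E | (b * w <= i)%N] :|: [set i | (3 < k i)%N] :|: mid_part n 0 1.
exists b, P, F, Ex; split; first by rewrite bK Ln.
  split => //; apply: leq_trans (leq_card_setU _ _) _; rewrite -(addn1 (_ + D)).
  apply: leq_add; last exact: card_ord_interval.
  by apply: leq_trans (leq_card_setU _ _) _; apply: leq_add.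
move=> i; have ki : (k i <= Q)%N by rewrite -ltnS.
rewrite /scarce_lower /scarce_upper; case: ifP => [_|/negbT iEx]; first by rewrite leq0n.
have i0 : (0 < i)%N.
  by rewrite lt0n; apply: contraNneq iEx => h0; rewrite !inE h0 orbT.
have kp := kpos i i0.
rewrite !inE !negb_or in iEx; case/andP: iEx => /andP[iE k3] _; rewrite -leqNgt in k3.
case: ifP => iI.
  rewrite k3 andbT; case: ifP => // /negbT iZ.
  rewrite ltnNge; apply/negP => k1; case/negP: iZ; apply/setDP; split.
    by apply: (subsetP FZ); apply/setIP; split; rewrite // inE.
  by apply/negP => iC; have := disjointFr FC iC; rewrite inE k1.
rewrite kp /=; case: ifP => // iM.
have iL : (b * w <= i)%N.
  by move: iI iM; rewrite !inE; move: (b.-1 * w)%N (b * w)%N => ? ?; lia.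
by move: iE; rewrite iL andbT -leqNgt.
Qed.

(* If two letters a, b are not both 1, then x^(a + b) <= pairw a * pairw b, although
   pairw 1 + pairw 2 < 1: this makes a mirrored constraint multiplicative. *)
Definition pairw (R : realType) (a : nat) : R :=
  if a == 1%N then 2 * gold R ^+ 3 else if a == 2 then 1 / 2 else gold R ^+ a / gold R ^+ 2.

Lemma pairw_gt0 (R : realType) (a : nat) : 0 < pairw R a.
Proof.
have x0 := gold_gt0 R; rewrite /pairw; case: ifP => _; first by rewrite mulr_gt0 ?exprn_gt0.
by case: ifP => _; [lra | rewrite divr_gt0 ?exprn_gt0].
Qed.

(** The hypothesis says that a and b are not both 1. The pair 1, 2 gives equality, and the other
    pairs have room to spare. *)
Lemma pairw_pair (R : realType) (a b : nat) : (a + b != 2)%N || (a != 1%N) ->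
  gold R ^+ a * gold R ^+ b <= pairw R a * pairw R b.
Proof.
have /andP[xl xu] := gold_bounds R; have x0 := gold_gt0 R; have x2 := goldE R.
have p2 : 0 < gold R ^+ 2 by rewrite exprn_gt0.
have q2 : 0 < gold R ^- 2 by rewrite invr_gt0.
have q21 : gold R ^- 2 * gold R ^+ 2 = 1 by rewrite mulVf ?gt_eqF.
have q4 : 1 <= gold R ^- 2 by rewrite invf_ge1 // x2; lra.
have o c : 0 < gold R ^+ c by rewrite exprn_gt0.
rewrite /pairw; case: (eqVneq a 1%N) => [->|a1]; case: (eqVneq b 1%N) => [->|b1] //= _.
- case: (eqVneq b 2) => [->|b2]; rewrite expr1.
    by rewrite (exprS _ 2) x2; lra.
  have -> : 2 * gold R ^+ 3 * (gold R ^+ b / gold R ^+ 2) =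
    2 * gold R * gold R ^+ b by field; rewrite gt_eqF.
  by have := mulr_gt0 x0 (o b); lra.
- case: (eqVneq a 2) => [->|a2]; rewrite expr1.
    by rewrite (exprS _ 2) x2; lra.
  have -> : gold R ^+ a / gold R ^+ 2 * (2 * gold R ^+ 3) =
    2 * gold R ^+ a * gold R by field; rewrite gt_eqF.
  by have := mulr_gt0 (o a) x0; lra.
- case: (eqVneq a 2) => [->|a2]; case: (eqVneq b 2) => [->|b2].
  + by rewrite x2; nra.
  + by have := o b; move: (gold R ^+ b) => y; rewrite x2 in q4 q2 p2 q21 *; nra.
  + by have := o a; move: (gold R ^+ a) => y; rewrite x2 in q4 q2 p2 q21 *; nra.
  + have := mulr_gt0 (o a) (o b).
    rewrite -[_ * (_ / _)]mulrACA => h; rewrite ler_peMr ?(ltW h) //.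
    by rewrite -[leLHS]mulr1; apply: ler_pM.
Qed.

Lemma pairw_le (R : realType) (a : nat) : pairw R a <= gold R ^+ a / gold R ^+ 2.
Proof.
have /andP[xl xu] := gold_bounds R; have x0 := gold_gt0 R; have x2 := goldE R.
have p2 : 0 < gold R ^+ 2 by rewrite exprn_gt0.
rewrite /pairw; case: eqP => [->|_]; last case: eqP => [->|_] //.
  by rewrite ler_pdivlMr // expr1 (exprS _ 2) x2; nra.
by rewrite divff ?gt_eqF //; lra.
Qed.

(** Squaring both sides groups every i with its mirror image s - i, a midpoint with itself, and
    [pairw_pair] applies to each group. *)
Lemma pairw_prod (R : realType) (n Q u a s : nat) (k : {ffun 'I_n -> 'I_Q.+1}) :
  (s < u + n)%N -> (u <= a)%N ->
  (forall i j : 'I_n, (u <= i)%N -> (u <= j)%N -> (i + j = s)%N -> (2 < k i + k j)%N) ->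
  \prod_(i in mirror_part n a s) gold R ^+ k i <=
  \prod_(i in mirror_part n a s) pairw R (k i).
Proof.
move=> sn ua hk; have x0 := gold_gt0 R.
pose f (i : 'I_n) : 'I_n := insubd i (s - i)%N.
have fE i : i \in mirror_part n a s -> f i = (s - i)%N :> nat.
  by rewrite inE val_insubd => hi; rewrite (_ : (_ < n)%N) //; lia.
have fS i : i \in mirror_part n a s -> f i \in mirror_part n a s.
  by move=> iS; rewrite inE fE //; move: iS; rewrite inE; lia.
have finj : {in mirror_part n a s &, injective f}.
  move=> i j iS jS /(congr1 val) /=; rewrite !fE // => E; apply: val_inj => /=.
  by move: iS jS E; rewrite !inE; lia.
have fim : f @: mirror_part n a s = mirror_part n a s.
  apply/eqP; rewrite eqEcard (card_in_imset finj) leqnn andbT.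
  by apply/subsetP => _ /imsetP[i /fS iS ->].
have reindex (g : 'I_n -> R) :
    \prod_(i in mirror_part n a s) g i = \prod_(i in mirror_part n a s) g (f i).
  by rewrite -{1}fim big_imset.
rewrite -(@ler_pXn2r _ 2) ?nnegrE //; first last.
- by apply: prodr_ge0 => i _; rewrite ltW // pairw_gt0.
- by apply: prodr_ge0 => i _; rewrite exprn_ge0 // ltW.
rewrite !expr2 [X in _ * X <= _]reindex [X in _ <= _ * X]reindex.
rewrite -!big_split /=; apply: ler_prod => i iS.
rewrite mulr_ge0 ?exprn_ge0 ?(ltW x0) //=; apply: pairw_pair.
have := hk i (f i); have := fS i iS; move: (iS); rewrite !inE fE // => h1 h2 h3.
have {h3} : (2 < k i + k (f i))%N by apply: h3; lia.
by move: (k i : nat) (k (f i) : nat) => ? ?; lia.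
Qed.

Definition mirror_letter (R : realType) (n a s : nat) (i : 'I_n) (c : nat) : R :=
  if i \in mirror_part n a s then pairw R c else gold R ^+ c.

(** Behind the block and off the mirrored interval the letters 1 and 2 weigh x + x^2 = 1. On [Ex]
    the other factors are at least x^2, and x^(-6) leaves x^(-4) for all letters, weighted by
    [pairw] or not. *)
Definition scarce_weight (R : realType) (n e L L' a s : nat) (P F Ex : {set 'I_n}) (i : 'I_n) : R :=
  gold R ^+ (i \in head_part n L) *
  2 ^+ (i \in few_new (sumnbrs 0 P) (head_part n L) F e :\: nbrs (sumnbrs 0 P) F) *
  (gold R)^-1 ^+ (i \in mid_part n L L') *
  (pairw R 1 + pairw R 2) ^+ (i \in mirror_part n a s) *
  (gold R ^- 6) ^+ (i \in Ex).

(** The sum equals 4 x - 3 / 2, because x^3 = 2 x - 1. *)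
Lemma pairw12 (R : realType) : gold R <= pairw R 1 + pairw R 2 <= gold R * (8 / 5).
Proof.
have /andP[xl xu] := gold_bounds R; have x2 := goldE R.
by rewrite /pairw /= (exprS _ 2) x2; apply/andP; split; nra.
Qed.

Lemma mirror_letter_ge0 (R : realType) (n a s : nat) (i : 'I_n) (c : nat) :
  0 <= mirror_letter R a s i c.
Proof.
by rewrite /mirror_letter; case: ifP => _; rewrite ltW ?pairw_gt0 ?exprn_gt0 ?gold_gt0.
Qed.

Lemma mirror_partF (n L' a s : nat) (i : 'I_n) :
  (L' <= a)%N -> (i < L')%N -> (i \in mirror_part n a s) = false.
Proof. by move=> La iL; rewrite inE leqNgt (leq_trans iL La). Qed.

Lemma head_part_lt (n L L' : nat) (i : 'I_n) : (L <= L')%N ->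
  i \in head_part n L -> (i < L')%N /\ (i \in mid_part n L L') = false.
Proof. by rewrite !inE; split; lia. Qed.

Lemma scarce_letters_le (R : realType) (n Q e L L' a s : nat) (P F Ex : {set 'I_n}) (i : 'I_n) :
  (L <= L')%N -> (L' <= a)%N ->
  \sum_(c < Q.+1) (scarce_lower e L P F Ex i <= c <= scarce_upper Q L L' Ex i)%N%:R * mirror_letter R a s i c
    <= scarce_weight R e L L' a s P F Ex i.
Proof.
move=> LL' La; have x0 := gold_gt0 R; have x1 := gold_lt1 R.
have x2 := goldE R.
have /andP[pi0 pi1] := pairw12 R.
have y0 : 0 < (gold R)^-1 by rewrite invr_gt0.
have y1 : 1 <= (gold R)^-1 by rewrite invf_ge1 // ltW.
have x0' : gold R != 0 by rewrite gt_eqF.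
have p2 : 0 < gold R ^+ 2 by rewrite exprn_gt0.
have q2 : 1 <= gold R ^- 2 by rewrite invf_ge1 // exprn_ile1 // ltW.
have /andP[_ th1] := theta_bounds R Q.
apply: le_trans (@sum_letters_le R Q _ _ (mirror_letter R a s i) (mirror_letter_ge0 R a s i)) _.
rewrite /scarce_lower /scarce_upper /scarce_weight; case: ifP => iEx.
  have sum0 : \sum_(0 <= c < Q.+1) mirror_letter R a s i c <= gold R ^- 4.
    apply: (@le_trans _ _ (\sum_(0 <= c < Q.+1) gold R ^+ c / gold R ^+ 2)).
      apply: ler_sum => c _; rewrite /mirror_letter; case: ifP => _; first exact: pairw_le.
      by rewrite ler_peMr // exprn_ge0 // ltW.
    rewrite -mulr_suml (_ : gold R ^- 4 = gold R ^- 2 / gold R ^+ 2); last by field.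
    rewrite ler_wpM2r ?invr_ge0 ?(ltW p2) //; apply: le_trans (sum_gold_theta _ _ _) _.
    by rewrite expr0 mul1r ler_piMl ?(ltW th1) // invr_ge0 ltW.
  apply: le_trans sum0 _; rewrite expr1.
  set x := gold R in x0 x1 y0 y1 x0' p2 pi0 *.
  have bitx (u : bool) : x <= x ^+ u by case: u; rewrite /= ?expr0 ?expr1 ?lexx ?ltW.
  have bity (u : bool) : 1 <= x^-1 ^+ u by case: u; rewrite /= ?expr0 ?expr1 ?lexx.
  have bit2 (u : bool) : 1 <= 2 ^+ u :> R by case: u; rewrite /= ?expr0 ?expr1 ?lexx ?ler1n.
  have bitp (u : bool) : x <= (pairw R 1 + pairw R 2) ^+ u.
    by case: u; rewrite /= ?expr0 ?expr1 // ltW.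
  have x6 : 0 <= x ^- 6 by rewrite invr_ge0 exprn_ge0 // ltW.
  apply: (@le_trans _ _ (x * 1 * 1 * x * x ^- 6)).
    by rewrite (_ : _ * x ^- 6 = x ^- 4) //; field.
  have xx : 0 <= x by exact: ltW.
  do 4 (apply: ler_pM; [by rewrite ?mulr1 ?(mulr_ge0 xx xx)|by rewrite ?ler01| |by []]).
  exact: bitx.
rewrite expr0 mulr1.
have mirF := @mirror_partF n L' a s i La.
case: ifP => iI.
  have [iL ->] := head_part_lt LL' iI; rewrite (mirF iL) !expr0 expr1 !mulr1.
  under eq_bigr => c _ do rewrite /mirror_letter (mirF iL).
  by case: ifP => _; rewrite ?expr0 ?expr1 ?sum_gold13 ?sum_gold23 ?mulr1.
rewrite (few_newF _ _ _ _ iI) !expr0 !mul1r.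
case: ifP => iM.
  have iL : (i < L')%N by move: iM; rewrite inE => /andP[].
  rewrite (mirF iL) expr0 expr1 mulr1.
  under eq_bigr => c _ do rewrite /mirror_letter (mirF iL).
  apply: le_trans (sum_gold_theta _ _ _) _; rewrite expr1.
  rewrite (_ : _ / _ = theta R Q / gold R); last by field.
  by rewrite ler_piMl ?(ltW y0) ?(ltW th1).
rewrite expr0 mul1r /mirror_letter /index_iota /= !big_cons big_nil addr0.
case: ifP => _; rewrite ?expr0 ?expr1 //.
by rewrite x2 addrC subrK.
Qed.

(** Here n <= 4 g + 8 L': if the mirrored interval is short, then the block lies far to the right
    and the head is long. *)
Lemma parts_length (n L L' w u s h g : nat) :
  (L' <= L + w)%N -> (L - 1 <= h)%N -> (s.+1 - 2 * u - 2 * L' <= g)%N ->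
  (n + 8 * u <= 4 * s.+1)%N -> (n <= 8 * (h + g + w.+1))%N.
Proof. lia. Qed.

(** Head and mirrored interval have weight at most b per position and, up to w + 1, fill an eighth
    of the positions; 40 = 8 * 5 converts this into five factors r^n. *)
Lemma scarce_weight_prod_le (R : realType) (x p b r : R) (n w h z m g ex D : nat) :
  0 < x -> x < 1 -> 0 < p -> p <= b -> b = x * (8 / 5) -> b < 1 ->
  0 < r -> r < 1 -> b <= r ^+ 40 ->
  2 ^+ z <= (8 / 5) ^+ (h + w) :> R -> (m <= w)%N -> (ex <= D)%N ->
  (n <= 8 * (h + g + w.+1))%N ->
  x ^+ h * 2 ^+ z * x^-1 ^+ m * p ^+ g * (x ^- 6) ^+ ex <=
  (x ^- 6) ^+ D * b^-1 * (x^-1 * (8 / 5) / b) ^+ w * (r ^+ n) ^+ 5.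
Proof.
move=> x0 x1 p0 pb bE b1 r0 r1 br hz hm hex hn.
have b0 : 0 < b by apply: lt_le_trans pb.
have y0 : 0 < x^-1 by rewrite invr_gt0.
have y1 : 1 <= x^-1 by rewrite invf_ge1 // ltW.
have pw y k : 0 < y -> 0 <= y ^+ k :> R by move=> ?; rewrite exprn_ge0 // ltW.
have x6 : 1 <= x ^- 6 by rewrite invf_ge1 ?exprn_gt0 // exprn_ile1 // ltW.
have x60 : 0 < x ^- 6 by rewrite invr_gt0 exprn_gt0.
have bi0 : 0 < b^-1 by rewrite invr_gt0.
have e85 : 0 < 8 / 5 :> R by lra.
have s1 : x ^+ h * 2 ^+ z <= b ^+ h * (8 / 5) ^+ w.
  by rewrite bE exprMn -mulrA -exprD ler_wpM2l ?pw.
have s2 : x^-1 ^+ m <= x^-1 ^+ w by rewrite ler_weXn2l.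
have s3 : p ^+ g <= b ^+ g by rewrite lerXn2r // nnegrE ltW.
have s4 : (x ^- 6) ^+ ex <= (x ^- 6) ^+ D by rewrite ler_weXn2l.
have s5 : b ^+ h * b ^+ g <= b^-1 ^+ w * b^-1 * (r ^+ n) ^+ 5.
  rewrite -exprD -exprSr.
  have -> : b ^+ (h + g) = b^-1 ^+ w.+1 * b ^+ (h + g + w.+1).
    by rewrite (exprD _ (h + g)) mulrCA -exprMn mulVf ?gt_eqF // expr1n mulr1.
  apply: ler_wpM2l; first exact: pw.
  apply: (@le_trans _ _ ((r ^+ 40) ^+ (h + g + w.+1))).
    by rewrite lerXn2r // nnegrE ?ltW // exprn_gt0.
  rewrite -!exprM; apply: ler_wiXn2l; rewrite ?(ltW r0) ?(ltW r1) //.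
  by move: hn; clear; lia.
apply: (@le_trans _ _ (b ^+ h * (8 / 5) ^+ w * x^-1 ^+ w * b ^+ g * (x ^- 6) ^+ D)).
  have px : 0 <= 2 ^+ z :> R by rewrite exprn_ge0.
  by do !(apply: ler_pM => //; rewrite ?mulr_ge0 ?pw //).
pose rest := (8 / 5) ^+ w * x^-1 ^+ w * (x ^- 6) ^+ D.
have rest0 : 0 <= rest by rewrite /rest !mulr_ge0 ?pw.
rewrite (_ : _ * _ * _ = b ^+ h * b ^+ g * rest); last by rewrite /rest; ring.
apply: le_trans (ler_wpM2r rest0 s5) _.
have -> : (x^-1 * (8 / 5) / b) ^+ w = x^-1 ^+ w * (8 / 5) ^+ w * b^-1 ^+ w.
  by rewrite -!exprMn.
rewrite le_eqVlt; apply/orP; left; apply/eqP; rewrite /rest; ring.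
Qed.

(** The containers make the head small, the mirrored constraint the positions behind the block. Of
    the five factors r^n three pay for P, F and Ex, one for the block length, and one remains. *)
Lemma few_large_letters (R : realType) (Q D : nat) :
  exists C r : R, [/\ 0 <= C, 0 < r, r < 1 &
  forall (n u s : nat) (A : pred {ffun 'I_n -> 'I_Q.+1}),
  (s < u + n)%N -> (n + 8 * u <= 4 * s.+1)%N ->
  (forall k : {ffun 'I_n -> 'I_Q.+1}, A k ->
    [/\ forall i : 'I_n, (0 < i)%N -> (0 < k i)%N,
        forall i j l : 'I_n, (i + j = l)%N -> (k l <= k i + k j)%N,
        (#|[set i | (3 < k i)%N]| <= D)%N &
        forall i j : 'I_n, (u <= i)%N -> (u <= j)%N -> (i + j = s)%N ->
          (2 < k i + k j)%N]) ->
  \sum_(k | A k) \prod_i gold R ^+ k i <= C * r ^+ n].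
Proof.
have x0 := gold_gt0 R; have x1 := gold_lt1 R.
have /andP[_ xu] := gold_bounds R.
have /andP[pi0 pi1] := pairw12 R.
have y0 : 0 < (gold R)^-1 by rewrite invr_gt0.
pose b : R := gold R * (8 / 5).
have b1 : b < 1 by rewrite /b; lra.
have b0 : 0 < b by rewrite /b; lra.
have [r [r0 r1 br]] := root_above 40 b0 b1.
pose a0 : R := (gold R)^-1 * (8 / 5) / b.
have a00 : 0 <= a0.
  apply: divr_ge0; last exact: ltW.
  by apply: mulr_ge0; [exact: ltW | lra].
have [K' hK'] := expr_absorb a0 r0 r1.
have hK : a0 * r ^+ K'.+1 <= 1.
  by apply: le_trans hK'; rewrite ler_wpM2l // exprS ler_piMl ?exprn_ge0 // ltW.
move: K'.+1 (ltn0Sn K') hK => K K0 hK.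
have [e e0 he] := sparse_subsets r0 r1.
(* The value t = 2 is enough for the 2/3 bound on containers. *)
have [C1 C10 hC1] := few_subsets (2 * e) r0 r1.
have [C2 C20 hC2] := few_subsets (K * (2 * e) + D).+1 r0 r1.
pose c0 : R := (gold R ^- 6) ^+ (K * (2 * e) + D).+1 * b^-1.
have c00 : 0 <= c0.
  by apply: mulr_ge0; rewrite ?exprn_ge0 ?invr_ge0 ?exprn_ge0 // ltW.
exists (K.+1%:R * C1 * C2 * (c0 * a0)), r; split => //.
  by apply: mulr_ge0; [rewrite !mulr_ge0 | exact: mulr_ge0 c00 a00].
move=> n u s A hs hn hA; pose w := (n %/ K).+1.
pose T : finType := ('I_K.+1 * {set 'I_n} * {set 'I_n} * {set 'I_n})%type.
pose L (b : 'I_K.+1) := (b.-1 * w)%N.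
pose L' (b : 'I_K.+1) := (b * w)%N.
pose q (d : T) (i : 'I_n) (a : 'I_Q.+1) : R := let: (b, P, F, Ex) := d in
  (scarce_lower e (L b) P F Ex i <= a <= scarce_upper Q (L b) (L' b) Ex i)%N%:R *
  mirror_letter R (maxn u (L' b)) s i a.
pose ok (d : T) := let: (b, P, F, Ex) := d in
  [&& (L b <= n)%N, (#|P| <= 2 * e)%N,
    fingerprint_ok 0 2 e (L b) (L' b) (head_part n (L b)) P F &
   (#|Ex| <= (K * (2 * e) + D).+1)%N].
pose M : R := c0 * a0 ^+ w * (r ^+ n) ^+ 5.
apply: (@le_trans _ _ (#|[set d | ok d]|%:R * M)).
  apply: (@sum_words_cover _ _ _ T A _ _ q) => [[[[c P] F] Ex] i a|k Ak|d].
  - by rewrite /q mulr_ge0 // mirror_letter_ge0.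
  - have [kpos ksub kbig kmir] := hA k Ak.
    have [c [P [F [Ex [/andP[cK cL] [P1 P2 P3] hbox]]]]] :=
      scarce_cover K0 e0 (isT : (0 < 2)%N) kpos ksub kbig.
    have cK1 : (c < K.+1)%N by [].
    exists (Ordinal cK1, P, F, Ex).
      by rewrite inE /= /L /L' /= P1 P2 P3 cL.
    rewrite /q /L /L' /w /=; under [leRHS]eq_bigr => i _ do rewrite hbox mul1r /mirror_letter.
    set S := mirror_part _ _ _.
    rewrite [leLHS](bigID (mem S)) [leRHS](bigID (mem S)) /=; apply: ler_pM.
    + by apply: prodr_ge0 => i _; rewrite exprn_ge0 // ltW.
    + by apply: prodr_ge0 => i _; rewrite exprn_ge0 // ltW.
    + rewrite [leRHS](eq_bigr (fun i => pairw R (k i))); last by move=> i ->.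
      exact: pairw_prod hs (leq_maxl _ _) kmir.
    + by apply: ler_prod => i /negbTE ->; rewrite lexx exprn_ge0 // ltW.
  - rewrite inE; case: d => [[[c P] F] Ex] /and4P[Ln _ /andP[_ s1] hEx].
    have /andP[LL' Lw] := block_bounds c w; rewrite -/(L c) -/(L' c) in LL' Lw.
    apply: (@le_trans _ _ (\prod_i scarce_weight R e (L c) (L' c) (maxn u (L' c)) s P F Ex i)).
      apply: ler_prod => i _; rewrite scarce_letters_le ?leq_maxr // andbT.
      by apply: sumr_ge0 => a _; rewrite mulr_ge0 // mirror_letter_ge0.
    rewrite /scarce_weight !big_split /= !prod_pow_card.
    have ZI I : few_new (sumnbrs 0 P) I F e \subset I.
      by apply/subsetP => i; rewrite inE => /andP[].
    have hm : (#|mid_part n (L c) (L' c)| <= w)%N.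
      by apply: leq_trans (card_ord_interval _ _ _) _; rewrite leq_subLR.
    have [_ {}s1] := few_new_sizes (isT : (1 < 2)%N) (ZI _) s1.
    have hl := parts_length Lw (card_ord_interval_ge 1 Ln)
      (card_mirror_part (L' c) hs) hn.
    apply: (scarce_weight_prod_le x0 x1 _ pi1 erefl b1 r0 r1 br) => //.
    + exact: lt_le_trans pi0.
    + apply: two_thirds; apply: leq_trans s1 _.
      by rewrite leq_mul2l leq_add2l.
have rn0 : 0 <= r ^+ n by rewrite exprn_ge0 // ltW.
have cardok : #|[set d | ok d]|%:R * (r ^+ n) ^+ 3 <= K.+1%:R * C1 * C2.
  pose SP := [set F : {set 'I_n} | (#|F| <= 2 * e)%N].
  pose SF := [set F : {set 'I_n} | (#|F| * e <= n)%N].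
  pose SE := [set F : {set 'I_n} | (#|F| <= (K * (2 * e) + D).+1)%N].
  apply: (@le_trans _ _ (#|setX (setX (setX [set: 'I_K.+1] SP) SF) SE|%:R
     * (r ^+ n) ^+ 3)).
    apply: ler_wpM2r; first exact: exprn_ge0.
    rewrite ler_nat; apply: subset_leq_card; apply/subsetP.
    move=> [[[c P] F] Ex]; rewrite !inE /= => /and4P[_ -> /andP[-> _] ->].
    by [].
  rewrite !cardsX cardsT card_ord !natrM.
  have -> : K.+1%:R * #|SP|%:R * #|SF|%:R * #|SE|%:R * (r ^+ n) ^+ 3 =
    K.+1%:R * (#|SP|%:R * r ^+ n) * (#|SE|%:R * r ^+ n) * (#|SF|%:R * r ^+ n) by ring.
  have hf : #|SF|%:R * r ^+ n <= 1 by exact: he.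
  rewrite -[leRHS]mulr1; apply: ler_pM => //.
  - by rewrite !mulr_ge0.
  - by rewrite !mulr_ge0.
  - apply: ler_pM; rewrite ?mulr_ge0 ?ler0n // ?hC2 //.
    by rewrite ler_wpM2l ?hC1.
have hw : a0 ^+ w * r ^+ n <= a0.
  rewrite /w exprS -mulrA ler_piMr //; exact: expr_divn_absorb.
have a0w : 0 <= a0 ^+ w by rewrite exprn_ge0.
have hw0 := mulr_ge0 a0w rn0.
have ho : 0 <= #|[set d | ok d]|%:R * (r ^+ n) ^+ 3 :> R.
  by apply: mulr_ge0; [exact: ler0n | exact: exprn_ge0].
apply: (@le_trans _ _ ((#|[set d | ok d]|%:R * (r ^+ n) ^+ 3) *
   (c0 * (a0 ^+ w * r ^+ n)) * r ^+ n)).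
  by rewrite le_eqVlt; apply/orP; left; apply/eqP; rewrite /M; ring.
apply: ler_wpM2r => //.
by apply: ler_pM => //; [exact: mulr_ge0 c00 hw0 | exact: ler_wpM2l].
Qed.

(** * Counting semigroups *)

Definition letters12 : pred (seq nat) := all [pred a | 1 <= a <= 2]%N.

(** Returning the lists for g - 1 and g makes the Fibonacci recursion structural. *)
Fixpoint words12_rec (g : nat) : seq (seq nat) * seq (seq nat) :=
  if g is g'.+1 then
    let: (v, w) := words12_rec g' in
    (w, [seq 1%N :: s | s <- w] ++ [seq 2%N :: s | s <- v])
  else ([::], [:: [::]]).

Definition words12 (g : nat) := (words12_rec g).2.

Lemma words12SS (g : nat) :
  words12 g.+2 = [seq 1%N :: s | s <- words12 g.+1] ++ [seq 2%N :: s | s <- words12 g].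
Proof. by rewrite /words12 /=; case: (words12_rec g). Qed.

Lemma words12_ind2 (P : nat -> Prop) : P 0%N -> P 1%N ->
  (forall g, P g -> P g.+1 -> P g.+2) -> forall g, P g.
Proof.
move=> h0 h1 h g; suff [] : P g /\ P g.+1 by [].
by elim: g => [|g [hg hgS]]; split => //; exact: h.
Qed.

Lemma mem_words12 (g : nat) (s : seq nat) :
  (s \in words12 g) = letters12 s && (sumn s == g).
Proof.
elim/words12_ind2: g s => [||g IH0 IH1] s.
- by case: s => [|[|a] s] //=; rewrite inE /= ?andbF.
- case: s => [|[|[|[|a]]] [|[|b] s]] //=; rewrite inE //= ?andbF //.
- rewrite words12SS mem_cat; apply/orP/andP.
    case=> /mapP[v]; rewrite ?IH0 ?IH1 => /andP[v12 /eqP vs] ->; split; rewrite //= ?vs //.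
  case; case: s => [|[|[|[|a]]] s] //= s12 /eqP E.
    by left; apply: map_f; rewrite IH1 s12 /=; apply/eqP; lia.
  by right; apply: map_f; rewrite IH0 s12 /=; apply/eqP; lia.
Qed.

Lemma words12_uniq (g : nat) : uniq (words12 g).
Proof.
elim/words12_ind2: g => [||g IH0 IH1] //.
rewrite words12SS cat_uniq !map_inj_uniq ?IH0 ?IH1 ?andbT /=; try by move=> s v [].
by apply/hasPn => _ /mapP[v _ ->]; apply/mapP => -[w _].
Qed.

(** The left side f satisfies f(g + 2) = x f(g + 1) + x^2 f(g), a convex combination, so it stays
    between f(1) = x and f(0) = 1. *)
Lemma size_words12_le (R : realType) (g : nat) :
  (size (words12 g))%:R * gold R ^+ g <= 1.
Proof.
have x0 := gold_gt0 R; have x1 := gold_lt1 R; have x2 := goldE R.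
elim/words12_ind2: g => [||g IH0 IH1].
- by rewrite mul1r expr0.
- by rewrite mul1r expr1 ltW.
rewrite words12SS size_cat !size_map natrD.
have -> : gold R ^+ g.+2 = gold R * gold R ^+ g.+1 by rewrite exprS.
rewrite mulrDl mulrCA {2}exprS (mulrA _ _ (gold R ^+ g)) -expr2 x2 (mulrCA _ (1 - _)).
have h : 0 <= 1 - gold R by lra.
have := ler_wpM2l (ltW x0) IH1; have := ler_wpM2l h IH0; lra.
Qed.

Lemma size_words12_ge (R : realType) (g : nat) :
  gold R <= (size (words12 g))%:R * gold R ^+ g.
Proof.
have x0 := gold_gt0 R; have x1 := gold_lt1 R; have x2 := goldE R.
elim/words12_ind2: g => [||g IH0 IH1].
- by rewrite mul1r expr0 ltW.
- by rewrite mul1r expr1.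
rewrite words12SS size_cat !size_map natrD.
have -> : gold R ^+ g.+2 = gold R * gold R ^+ g.+1 by rewrite exprS.
rewrite mulrDl mulrCA {2}exprS (mulrA _ _ (gold R ^+ g)) -expr2 x2 (mulrCA _ (1 - _)).
have h : 0 <= 1 - gold R by lra.
have := ler_wpM2l (ltW x0) IH1; have := ler_wpM2l h IH0; lra.
Qed.

Lemma size_le_sumn (s : seq nat) : all (leq 1) s -> (size s <= sumn s)%N.
Proof. by elim: s => //= a s IH /andP[a0 /IH]; lia. Qed.

Lemma sumn_le_mul (c : nat) (s : seq nat) : all (leq^~ c) s -> (sumn s <= c * size s)%N.
Proof. elim: s => //= a s IH /andP[/= a0 /IH]; by rewrite mulnS; exact: leq_add. Qed.

(** Removing the last N letters, all 1, is injective. Since the letters are at most 2, the condition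
    2 N <= g ensures that there are N letters to remove. *)
Lemma count_far_low (g N : nat) (Ws : seq (seq nat)) :
  uniq Ws -> (forall s : seq nat, s \in Ws -> kunz s /\ sumn s = g) -> (2 * N <= g)%N ->
  (count (far_low N) Ws <= size (words12 (g - N)))%N.
Proof.
move=> uW hW Ng; pose f (s : seq nat) := take (size s - N) s.
have fE s : s \in filter (far_low N) Ws -> s = f s ++ nseq N 1%N /\ f s \in words12 (g - N).
  rewrite mem_filter => /andP[/andP[s2 s1] /hW[[spos _ _] sg]].
  have Ns : (N <= size s)%N by have := leq_trans Ng; rewrite -{1}sg => /(_ _ (sumn_le_mul s2)); rewrite leq_pmul2l.
  have sE : s = f s ++ nseq N 1%N.
    rewrite -{1}(cat_take_drop (size s - N) s); congr cat.
    by rewrite (all_pred1P _ _ s1) size_drop subKn.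
  split=> //; rewrite mem_words12; apply/andP; split.
    apply/allP => a /mem_take as_; rewrite /=.
    by rewrite (allP spos) //= (allP s2).
  by apply/eqP; move: sg; rewrite {1}sE sumn_cat sumn_nseq; lia.
rewrite -size_filter -(size_map f); apply: uniq_leq_size.
  rewrite map_inj_in_uniq ?filter_uniq // => s v /fE[sE _] /fE[vE _] E.
  by rewrite sE vE E.
by move=> _ /mapP[s /fE[_ h] ->].
Qed.

(** Each step of the recursion either adds a letter, with factor z, or keeps the length. *)
Lemma sum_compositions (R : realType) (z : R) (g : nat) : 0 <= z -> z <= 1 ->
  \sum_(s <- compositions g) z ^+ size s <= (1 + z) ^+ g.
Proof.
move=> z0 z1; elim: g => [|g IH]; first by rewrite /= big_seq1 !expr0.
rewrite /= big_cat !big_map exprS mulrDl mul1r addrC; apply: lerD.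
  rewrite /=; under eq_bigr => s _ do rewrite exprS.
  by rewrite -mulr_sumr ler_wpM2l.
by apply: le_trans IH; apply: ler_sum => -[|a s].
Qed.

Lemma sum_uniq_sub (R : realType) (T : eqType) (l l' : seq T) (F : T -> R) :
  (forall t, 0 <= F t) -> uniq l -> {subset l <= l'} ->
  \sum_(t <- l) F t <= \sum_(t <- l') F t.
Proof.
move=> F0; elim: l l' => [|a l IH] l' /=; first by rewrite big_nil sumr_ge0.
move=> /andP[al ul] sub.
have al' : a \in l' by apply: sub; rewrite mem_head.
rewrite big_cons (perm_big _ (perm_to_rem al')) big_cons /= lerD2l.
apply: IH => // t tl; have := sub t; rewrite inE tl orbT => /(_ isT) tl'.
have := perm_mem (perm_to_rem al') t; rewrite tl' inE => /esym/orP[/eqP ta|//].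
by rewrite -ta tl in al.
Qed.

(** The words are compositions of g; a short one contributes at least z^(g/e) to a sum of at most (1
    + z)^g. *)
Lemma count_short (R : realType) (r : R) : 0 < r -> r < 1 ->
  exists2 e : nat, (0 < e)%N & forall (g : nat) (Ws : seq (seq nat)),
  uniq Ws -> (forall s : seq nat, s \in Ws -> kunz s /\ sumn s = g) ->
  (count (fun s => size s * e <= g)%N Ws)%:R * r ^+ g <= 1.
Proof.
move=> r0 r1; have [z [e e0 [z0 z1 hz]]] := sparse_bound r0 r1.
exists e => // g Ws uW hW; set P := (fun s : seq nat => _).
have z0' := ltW z0.
have h1 : \sum_(s <- filter P Ws) z ^+ size s <= (1 + z) ^+ g.
  apply: le_trans (sum_compositions g z0' z1); apply: sum_uniq_sub.
  - by move=> s; rewrite exprn_ge0.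
  - exact: filter_uniq.
  - move=> s; rewrite mem_filter => /andP[_ /hW[[spos _ _] <-]].
    exact: mem_compositions.
have h2 : (count P Ws)%:R * z ^+ (g %/ e) <= (1 + z) ^+ g.
  apply: le_trans h1; rewrite -size_filter -sum1_size natr_sum mulr_suml.
  rewrite big_seq [leRHS]big_seq; apply: ler_sum => s.
  rewrite mem_filter mul1r => /andP[hs _].
  by rewrite ler_wiXn2l // leq_divRL.
have zf : 0 < z ^+ (g %/ e) by rewrite exprn_gt0.
rewrite -(ler_pM2r zf) mul1r; apply: le_trans (hz g (g %/ e)%N (leq_trunc_div _ _)).
by rewrite mulrAC mulrC ler_wpM2l // exprn_ge0 // ltW.
Qed.

Lemma sumn_kunz_coord (s : seq nat) : sumn s = (\sum_(i < (size s).+1) kunz_coord s i)%N.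
Proof.
by rewrite -[LHS]/(sumn (0%N :: s)) sumnE (big_nth 0%N) big_mkord.
Qed.

(* Pair i with l - i modulo the multiplicity. *)
Lemma letter_bound (s : seq nat) (l : nat) : kunz s -> (l < (size s).+1)%N ->
  ((size s).+1 * kunz_coord s l <= 2 * sumn s + (size s).+1)%N.
Proof.
move=> [_ ksub kcarry] hl; pose l' := Ordinal hl.
(* Subtraction on these ordinals is modulo m. *)
pose sigma (i : 'I_(size s).+1) : 'I_(size s).+1 := l' - i.
have sigK : involutive sigma by move=> i; rewrite /sigma subKr.
have E2 : (2 * sumn s = \sum_(i < (size s).+1) (kunz_coord s i + kunz_coord s (sigma i)))%N.
  rewrite big_split /= mul2n -addnn sumn_kunz_coord; congr addn.
  by rewrite (reindex_inj (inv_inj sigK)).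
rewrite E2 -[X in (_ + X)%N](card_ord (size s).+1) -sum1_card -big_split /=.
rewrite -[X in (X * _)%N](card_ord (size s).+1) -sum_nat_const.
apply: leq_sum => i _; have hi := ltn_ord i; have hj := ltn_ord (sigma i).
have sE : (sigma i = (l + ((size s).+1 - i)) %% (size s).+1 :> nat)%N.
  by rewrite /sigma /= modnDmr.
rewrite addn1; case: (leqP i l) => il.
  have E : (i + sigma i)%N = l.
    rewrite sE addnBA ?(ltnW hi) // addnC -addnBAC // modnDr modn_small ?subnK //.
    exact: leq_ltn_trans (leq_subr _ _) hl.
  by have := ksub i (sigma i); rewrite E => /(_ hl)/leqW.
have E : (i + sigma i = l + (size s).+1)%N.
  have h a b c : (c < a)%N -> (a < b)%N -> (c < b)%N -> (a + (c + (b - a)) %% b = c + b)%N.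
    by move=> ca ab cb; rewrite modn_small; lia.
  by rewrite sE h.
exact: kcarry hi hj E.
Qed.

(** A letter q satisfies (q - 1) m <= 2 g < 2 e m. *)
Lemma letters_small (s : seq nat) (e g : nat) : kunz s -> sumn s = g ->
  (g < size s * e)%N -> all (leq^~ (2 * e)%N) s.
Proof.
move=> ks sg gl; apply/(all_nthP 0%N) => i hi /=.
have := @letter_bound s i.+1 ks; rewrite ltnS sg => /(_ hi).
rewrite -[kunz_coord s i.+1]/(nth 0%N s i); move: (nth _ _ _) => q.
by move: (size s) gl => n gl h; rewrite leqNgt; apply/negP => q2; nia.
Qed.

(** Position 0 holds k_0 = 0. The encoding is faithful for letters at most Q, as [inord] replaces
    larger values by a default; n may be less than the multiplicity, for prefixes. *)
Definition word_ffun (n Q : nat) (s : seq nat) : {ffun 'I_n -> 'I_Q.+1} :=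
  [ffun i : 'I_n => inord (kunz_coord s i)].

Lemma kunz_coord_le (Q : nat) (s : seq nat) (i : nat) : all (leq^~ Q) s -> (kunz_coord s i <= Q)%N.
Proof.
case: i => // i h; rewrite /kunz_coord /=; case: (ltnP i (size s)) => hi.
  exact: (allP h _ (mem_nth 0%N hi)).
by rewrite nth_default.
Qed.

Lemma word_ffunE (n Q : nat) (s : seq nat) (i : 'I_n) : all (leq^~ Q) s ->
  word_ffun n Q s i = kunz_coord s i :> nat.
Proof. by move=> h; rewrite ffunE inordK // ltnS kunz_coord_le. Qed.

Lemma count_words (R : realType) (n Q g : nat) (Ws : seq (seq nat)) (P : pred (seq nat)) :
  uniq Ws -> (forall s : seq nat, s \in Ws -> kunz s /\ sumn s = g) ->
  (forall s : seq nat, P s -> (size s).+1 = n /\ all (leq^~ Q) s) ->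
  (count P Ws)%:R * gold R ^+ g =
  \sum_(k in [seq word_ffun n Q s | s <- filter P Ws]) \prod_i gold R ^+ k i.
Proof.
move=> uW hW hP; have inj : {in filter P Ws &, injective (word_ffun n Q)}.
  move=> s v; rewrite !mem_filter => /andP[/hP[sn sQ] _] /andP[/hP[vn vQ] _] E.
  apply: (@eq_from_nth _ 0%N); first by apply: succn_inj; rewrite sn vn.
  move=> i hi; have hin : (i.+1 < n)%N by rewrite -sn ltnS.
  have := congr1 (fun k : {ffun 'I_n -> 'I_Q.+1} => nat_of_ord (k (Ordinal hin))) E.
  by rewrite !word_ffunE.
rewrite -big_uniq ?map_inj_in_uniq ?filter_uniq //= big_map.
rewrite -size_filter -sum1_size natr_sum mulr_suml.
rewrite big_seq [RHS]big_seq; apply: eq_bigr => s.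
rewrite mem_filter => /andP[/hP[sn sQ] /hW[_ sg]].
rewrite mul1r -expr_sum -sg sumn_kunz_coord; congr (_ ^+ _).
by subst n; apply: eq_bigr => i _; rewrite word_ffunE.
Qed.

Lemma kunz_word_ffun (n Q : nat) (s : seq nat) : kunz s -> (n <= (size s).+1)%N ->
  all (leq^~ Q) s ->
  let k := word_ffun n Q s in
  (forall i : 'I_n, (0 < i)%N -> (0 < k i)%N) /\
  (forall i j l : 'I_n, (i + j = l)%N -> (k l <= k i + k j)%N).
Proof.
move=> [spos ksub kcarry] sn sQ k; split=> [i i0|i j l E].
  rewrite word_ffunE // kunz_coord_gt0 //; exact: leq_trans (ltn_ord i) sn.
rewrite !word_ffunE // -E; apply: ksub; rewrite E.
exact: leq_trans (ltn_ord l) sn.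
Qed.

Lemma kunz_word_ffun_carry (n Q : nat) (s : seq nat) : kunz s -> (size s).+1 = n ->
  all (leq^~ Q) s ->
  let k := word_ffun n Q s in
  forall i j l : 'I_n, (i + j = l + n)%N -> (k l <= (k i + k j).+1)%N.
Proof.
move=> [_ _ kcarry] sn sQ k i j l E; rewrite !word_ffunE //.
by apply: kcarry; rewrite sn.
Qed.

Lemma count_le_sum (T : Type) (I : finType) (P : pred T) (Pi : I -> pred T) (l : seq T) :
  (forall t, P t -> exists i, Pi i t) -> (count P l <= \sum_i count (Pi i) l)%N.
Proof.
move=> h; elim: l => [|a l IH] /=; first by rewrite sum_nat_const muln0.
rewrite big_split /=; apply: leq_add => //.
by case Pa : (P a) => //; have [i Pia] := h a Pa; rewrite (bigD1 i) //= Pia leq_addr.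
Qed.

Lemma linear_absorb (R : realType) (r : R) : 0 < r -> r < 1 ->
  exists C s : R, [/\ 0 <= C, 0 < s, s < 1 & forall n, n.+1%:R * r ^+ n <= C * s ^+ n].
Proof.
move=> r0 r1; have [s [s0 s1 hs]] := root_above 2 r0 r1.
have [z [z0 z1 hz]] := exists_slack s0 s1.
exists z^-1, s; split => //; first by rewrite invr_ge0 ltW.
move=> n; have sn : 0 <= s ^+ n by rewrite exprn_ge0 // ltW.
rewrite [leRHS]mulrC ler_pdivlMr // (mulrC n.+1%:R) -mulrA.
have h1 : n.+1%:R * z <= (1 + z) ^+ n.
  apply: le_trans (bernoulli_ge n _); last lra.
  by rewrite mulr_natl mulrS lerD2r.
have h2 : r ^+ n <= s ^+ n * s ^+ n.
  by rewrite -exprMn -expr2 lerXn2r // nnegrE ?exprn_ge0 // ltW.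
apply: (@le_trans _ _ (s ^+ n * s ^+ n * (1 + z) ^+ n)).
  by apply: ler_pM; rewrite ?exprn_ge0 ?mulr_ge0 ?(ltW z0) ?(ltW r0).
rewrite -mulrA ler_piMr // -exprMn mulrC exprn_ile1 //.
by rewrite mulr_ge0 ?(ltW s0) // addr_ge0 // ltW.
Qed.

(* The constraint i + j = l (mod n) is mirrored on ]0, l[ about l / 2 and on
   ]l, n[ about (l + n) / 2. *)
Lemma longer_segment (n l : nat) : (4 <= n)%N -> (l < n)%N ->
  let u := if (n <= 2 * l)%N then 1%N else l.+1 in
  let v := if (n <= 2 * l)%N then l else (l + n)%N in
  (v < u + n)%N /\ (n + 8 * u <= 4 * v.+1)%N.
Proof. by move=> n4 ln /=; case: ifP; lia. Qed.

(** Either more than D letters exceed 3, or some k_l > 3 yields a mirrored constraint. The at most n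
    choices of l are absorbed by a slightly worse rate. *)
Lemma count_high (R : realType) (e : nat) : (0 < e)%N ->
  exists C r : R, [/\ 0 <= C, 0 < r, r < 1 &
  forall (g : nat) (Ws : seq (seq nat)), uniq Ws ->
  (forall s : seq nat, s \in Ws -> kunz s /\ sumn s = g) ->
  forall n, (4 <= n)%N ->
  (count (fun s => [&& (size s).+1 == n, g < size s * e & far_high s])%N Ws)%:R
    * gold R ^+ g <= C * r ^+ n].
Proof.
move=> e0; pose Q := (2 * e)%N.
have [D [CA [rA [CA0 rA0 rA1 hA]]]] := many_large_letters R Q.
have [CB [rB [CB0 rB0 rB1 hB]]] := few_large_letters R Q D.
pose r := Num.max rA rB.
have r0 : 0 < r by rewrite lt_max rA0.
have r1 : r < 1 by rewrite gt_max rA1.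
have [C [s [C0 s0 s1 hs]]] := linear_absorb r0 r1.
exists ((CA + CB) * C), s; split => //; first by rewrite mulr_ge0 ?addr_ge0.
move=> g Ws uW hW n n4; set P := (fun s : seq nat => _).
pose big (t : seq nat) := [set i : 'I_n | (3 < word_ffun n Q t i)%N].
pose Pi (o : option 'I_n) (t : seq nat) : bool :=
  [&& t \in Ws, P t & if o is Some l then (#|big t| <= D)%N && (3 < kunz_coord t l)%N
                      else (D < #|big t|)%N].
have good o t : Pi o t -> [/\ kunz t, sumn t = g, (size t).+1 = n & all (leq^~ Q) t].
  move=> /and3P[/hW[kt gt] /and3P[/eqP tn gl _] _]; split => //.
  exact: letters_small kt gt gl.
have cover t : t \in Ws -> P t -> exists o, Pi o t.
  move=> tW Pt; case: (leqP #|big t| D) => hD; last first.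
    by exists None; rewrite /Pi tW Pt.
  have /and3P[/eqP tn _ /(has_nthP 0%N)[i hi hl]] := Pt.
  have hin : (i.+1 < n)%N by rewrite -tn ltnS.
  by exists (Some (Ordinal hin)); rewrite /Pi tW Pt hD.
have bound o : (count (Pi o) Ws)%:R * gold R ^+ g <= (CA + CB) * r ^+ n.
  rewrite (count_words R (n := n) (Q := Q) uW hW) => [|t /good[_ _ tn tQ]] //.
  have memP (k : {ffun 'I_n -> 'I_Q.+1}) :
      k \in [seq word_ffun n Q t | t <- filter (Pi o) Ws] ->
      exists2 t, k = word_ffun n Q t & Pi o t.
    by move=> /mapP[t]; rewrite mem_filter => /andP[Pt _] ->; exists t.
  have rn0 : 0 <= r ^+ n by rewrite exprn_ge0 // ltW.
  case: o memP => [l|] memP.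
    pose u := if (n <= 2 * l)%N then 1%N else l.+1.
    pose v := if (n <= 2 * l)%N then l : nat else (l + n)%N.
    apply: (@le_trans _ _ (CB * rB ^+ n)); last first.
      apply: ler_pM; rewrite ?exprn_ge0 ?(ltW rB0) ?lerDr //.
      by rewrite lerXn2r ?nnegrE ?(ltW rB0) ?(ltW r0) // le_max lexx orbT.
    have [hv hu] := longer_segment n4 (ltn_ord l).
    apply: (hB n u v _ hv hu) => k /memP[t -> Pt].
    - have [kt gt tn tQ] := good _ _ Pt.
      have /and3P[_ _ /andP[tD tl]] := Pt.
      have [h1 h2] := kunz_word_ffun kt (eq_leq (esym tn)) tQ.
      have h3 := kunz_word_ffun_carry kt tn tQ.
      split => // i j; rewrite /u /v -(word_ffunE l tQ) in tl *.
      (* From k_l > 3 the sum k_i + k_j exceeds 2 even when a carry takes 1 away. *)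
      case: ifP => _ _ _ E; first by apply: leq_trans (h2 i j l E); exact: ltnW.
      by rewrite -ltnS; apply: leq_trans tl (h3 i j l E).
  apply: (@le_trans _ _ (CA * rA ^+ n)); last first.
    apply: ler_pM; rewrite ?exprn_ge0 ?(ltW rA0) ?lerDl //.
    by rewrite lerXn2r ?nnegrE ?(ltW rA0) ?(ltW r0) // le_max lexx.
  apply: hA => k /memP[t -> Pt].
  have [kt gt tn tQ] := good _ _ Pt; have /and3P[_ _ tD] := Pt.
  have [h1 h2] := kunz_word_ffun kt (eq_leq (esym tn)) tQ.
  by split => //; exact: kunz_word_ffun_carry kt tn tQ.
apply: (@le_trans _ _ (n.+1%:R * ((CA + CB) * r ^+ n))); last first.
  by rewrite mulrCA -[leRHS]mulrA ler_wpM2l // addr_ge0.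
apply: (@le_trans _ _ ((\sum_o count (Pi o) Ws)%:R * gold R ^+ g)).
  rewrite ler_wpM2r ?exprn_ge0 ?(ltW (gold_gt0 R)) // ler_nat.
  rewrite (eq_in_count (a2 := fun t => (t \in Ws) && P t)); last by move=> t ->.
  by apply: count_le_sum => t /andP[]; exact: cover.
have cO : #|[set: option 'I_n]| = n.+1 by rewrite cardsT card_option card_ord.
rewrite natr_sum mulr_suml -[in leRHS]cO.
rewrite (eq_bigl (mem [set: option 'I_n])); last by move=> o; rewrite /= inE.
by rewrite mulr_natl -sumr_const; apply: ler_sum.
Qed.

(** * Words whose last 3 is at a given position *)

Definition mid_at (l : nat) (s : seq nat) : bool :=
  [&& (l <= size s)%N, all (leq^~ 3) s, kunz_coord s l == 3 & all (leq^~ 2) (drop l s)].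

Lemma word_ffun_take (l Q : nat) (s v : seq nat) : (l <= size s)%N -> (l <= size v)%N ->
  all (leq^~ Q) s -> all (leq^~ Q) v -> word_ffun l.+1 Q s = word_ffun l.+1 Q v ->
  take l s = take l v.
Proof.
move=> ls lv sQ vQ E; apply: (@eq_from_nth _ 0%N); first by rewrite !size_takel.
move=> i; rewrite size_takel // => hi; rewrite !nth_take //.
have hil : (i.+1 < l.+1)%N by [].
have := congr1 (fun k : {ffun 'I_l.+1 -> 'I_Q.+1} => nat_of_ord (k (Ordinal hil))) E.
by rewrite !word_ffunE.
Qed.

Lemma sum_word_ffun (l Q : nat) (s : seq nat) : (l <= size s)%N -> all (leq^~ Q) s ->
  (\sum_i word_ffun l.+1 Q s i)%N = sumn (take l s).
Proof.
move=> ls sQ; rewrite sumn_kunz_coord size_takel //; apply: eq_bigr => i _.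
rewrite word_ffunE //; case: i => [[|i] hi] //.
by rewrite /kunz_coord /= nth_take.
Qed.

Lemma mid_at_split (l : nat) (s : seq nat) : mid_at l.+1 s ->
  s = take l s ++ 3%N :: drop l.+1 s.
Proof.
move=> /and4P[ls _ /eqP k3 _]; rewrite -{1}(cat_take_drop l s) (drop_nth 0%N ls).
by rewrite -[nth _ _ _]/(kunz_coord s l.+1) k3.
Qed.

(** Group the words by the prefix before the last 3. The remainders are words over {1, 2} of fixed
    sum, of total weight at most 1, and the prefixes obey k_i + k_j >= 3 whenever i + j is the
    position of that 3. *)
Lemma count_mid (R : realType) : exists C r : R, [/\ 0 <= C, 0 < r, r < 1 &
  forall (g : nat) (Ws : seq (seq nat)), uniq Ws ->
  (forall s : seq nat, s \in Ws -> kunz s /\ sumn s = g) ->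
  forall l, (2 <= l)%N -> (count (mid_at l) Ws)%:R * gold R ^+ g <= C * r ^+ l].
Proof.
have x0 := gold_gt0 R; have x1 := gold_lt1 R.
have [C [r [C0 r0 r1 hB]]] := few_large_letters R 3 0.
exists C, r; split => // g Ws uW hW [//|l] l2.
pose F := filter (mid_at l.+1) Ws.
(* The 3 is at position l + 1, and [cut] keeps positions 0 to l. *)
pose cut := word_ffun l.+1 3.
have FP s : s \in F -> [/\ mid_at l.+1 s, kunz s & sumn s = g].
  by rewrite mem_filter => /andP[ms /hW[]].
pose A : pred {ffun 'I_l.+1 -> 'I_4} := [pred k | k \in [seq cut s | s <- F]].
have AP k : A k -> exists2 s, s \in F & k = cut s.
  by move=> /mapP[s sF ->]; exists s.
apply: (@le_trans _ _ (\sum_(k | A k) \prod_i gold R ^+ k i)); last first.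
  apply: (hB l.+1 1%N l.+1 A) => [||k /AP[s /FP[/and4P[ls s3 /eqP k3 _] ks _] ->]].
  - by rewrite add1n.
  - by move: l2; clear; lia.
  have [h1 h2] := kunz_word_ffun ks (leqW ls) s3.
  split=> //.
    rewrite leqn0 cards_eq0; apply/eqP/setP => i; rewrite !inE.
    by rewrite ltnNge -ltnS ltn_ord.
  move=> i j i1 j1 E; rewrite !word_ffunE //.
  case: ks => _ ksub _; have := ksub i j; rewrite E k3.
  by apply; rewrite ltnS.
apply: (@le_trans _ _ ((\sum_(k | A k) count (fun s => cut s == k) F)%N%:R * gold R ^+ g)).
  rewrite ler_wpM2r ?exprn_ge0 ?(ltW x0) // ler_nat -size_filter -/F.
  rewrite [leqRHS]big_mkcond /=.
  apply: (@leq_trans (\sum_k count (fun s => A k && (cut s == k)) F)%N).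
    rewrite -(count_predT F) (eq_in_count (a2 := mem F)); last by move=> s sF; rewrite /= sF.
    by apply: count_le_sum => s sF; exists (cut s); rewrite eqxx andbT; exact: map_f.
  apply: leq_sum => k _; case: (A k) => //=.
  by rewrite (@eq_count _ _ pred0) ?count_pred0.
rewrite natr_sum mulr_suml; apply: ler_sum => k /AP[s0 s0F ->{k}].
have [m0 _ sg0] := FP s0 s0F.
have /and4P[ls0 s03 _ _] := m0.
set S := sumn (take l s0).
have sE s : s \in F -> cut s = cut s0 ->
    s = take l s0 ++ 3%N :: drop l.+1 s /\ (g = S + 3 + sumn (drop l.+1 s))%N.
  move=> sF E; have [ms _ sg] := FP s sF; have /and4P[ls s3 _ _] := ms.
  have tE := word_ffun_take (ltnW ls) (ltnW ls0) s3 s03 E.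
  have sE := mid_at_split ms; split; first by rewrite -tE.
  by rewrite -sg {1}sE sumn_cat /= tE addnA.
have [_ g0] := sE s0 s0F erefl.
set h := sumn (drop l.+1 s0) in g0.
have cnt : (count (fun s => cut s == cut s0) F <= size (words12 h))%N.
  rewrite -size_filter -(size_map (drop l.+1)); apply: uniq_leq_size.
    rewrite map_inj_in_uniq ?filter_uniq // => s v.
    rewrite mem_filter => /andP[/eqP sc sF].
    rewrite mem_filter => /andP[/eqP vc vF] E.
    by have [-> _] := sE s sF sc; have [-> _] := sE v vF vc; rewrite E.
  move=> w /mapP[s]; rewrite mem_filter => /andP[/eqP sc sF] ->.
  have [ms [s1 _ _] sg] := FP s sF; have /and4P[_ _ _ d2] := ms.
  have [_ gE] := sE s sF sc.
  rewrite mem_words12; apply/andP; split.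
    apply/allP => a ad; rewrite /= (allP s1) ?(mem_drop ad) //=.
    exact: (allP d2).
  by apply/eqP; apply: (@addnI (S + 3)); rewrite -gE.
have -> : \prod_i gold R ^+ cut s0 i = gold R ^+ S.
  by rewrite -expr_sum sum_word_ffun // ltnW.
apply: (@le_trans _ _ ((size (words12 h))%:R * gold R ^+ g)).
  by rewrite ler_wpM2r ?exprn_ge0 ?(ltW x0) // ler_nat.
rewrite g0 -addnA exprD mulrCA -[leRHS]mulr1 ler_wpM2l ?exprn_ge0 ?(ltW x0) //.
apply: le_trans (size_words12_le R h); rewrite ler_wpM2l // exprD ler_piMl ?exprn_ge0 ?(ltW x0) //.
by rewrite exprn_ile1 // ltW.
Qed.

(** * Union bound and conclusion *)

Lemma count_predU_le (T : Type) (P P' : pred T) (l : seq T) :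
  (count (fun t => P t || P' t) l <= count P l + count P' l)%N.
Proof. by rewrite -count_predUI leq_addr. Qed.

Lemma count_has_le (T I : Type) (P : I -> pred T) (r : seq I) (l : seq T) :
  (count (fun t => has (P^~ t) r) l <= \sum_(i <- r) count (P i) l)%N.
Proof.
elim: r => [|i r IH]; first by rewrite big_nil count_pred0.
by rewrite big_cons; apply: leq_trans (count_predU_le _ _ _) _; rewrite leq_add2l.
Qed.

Lemma count_tail (R : realType) (T : Type) (P : nat -> pred T) (l : seq T)
    (M k : nat) (C r y : R) :
  0 <= C -> 0 < r -> r < 1 -> 0 <= y ->
  (forall n, (M <= n)%N -> (count (P n) l)%:R * y <= C * r ^+ n) ->
  (count (fun t => has (P^~ t) (iota M k)) l)%:R * y <= C * (r ^+ M / (1 - r)).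
Proof.
move=> C0 r0 r1 y0 h.
apply: (@le_trans _ _ ((\sum_(n <- iota M k) count (P n) l)%N%:R * y)).
  by rewrite ler_wpM2r // ler_nat count_has_le.
rewrite natr_sum mulr_suml.
apply: (@le_trans _ _ (\sum_(n <- iota M k) C * r ^+ n)).
  rewrite big_seq [leRHS]big_seq; apply: ler_sum => n.
  by rewrite mem_iota => /andP[Mn _]; exact: h.
rewrite -mulr_sumr ler_wpM2l //.
have -> : iota M k = index_iota M (M + k) by rewrite /index_iota addKn.
exact: sum_geometric_le.
Qed.

Lemma expr_small (R : realType) (a r eta : R) : 0 <= a -> 0 < r -> r < 1 -> 0 < eta ->
  exists n0, forall n, (n0 <= n)%N -> a * r ^+ n <= eta.
Proof.
move=> a0 r0 r1 e0; have [n0 hn0] := expr_absorb (a / eta) r0 r1.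
exists n0 => n hn; apply: (@le_trans _ _ (a * r ^+ n0)).
  by rewrite ler_wpM2l // ler_wiXn2l // ltW.
by rewrite mulrAC ler_pdivrMr // mul1r in hn0.
Qed.

(** A word that is not short has e * size s > g >= e M, so its length exceeds M; and no length
    exceeds g, which makes the ranges finite. *)
Lemma far_cover (N M e g : nat) (s : seq nat) : kunz s -> sumn s = g -> (e * M <= g)%N ->
  [|| far_low N s, far_mid N s | far_high s] ->
  [|| far_low N s, (size s * e <= g)%N,
      has (mid_at^~ s) (iota N.+1 g.+1) |
      has (fun n => [&& (size s).+1 == n, g < size s * e & far_high s])%N (iota M g.+2)].
Proof.
move=> [s1 _ _] sg eM; have sz : (size s <= g)%N by rewrite -sg; exact: size_le_sumn.
case/or3P => [->//|/andP[s3 /existsP[l /and3P[Nl kl dl]]]|hi].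
  apply/or4P; apply: Or43; apply/hasP; exists (l : nat).
    by rewrite mem_iota Nl /=; have := ltn_ord l; lia.
  by rewrite /mid_at s3 kl dl -ltnS ltn_ord.
case: (leqP (size s * e) g) => [_|gs]; first by rewrite orbT.
apply/or4P; apply: Or44; apply/hasP; exists (size s).+1; last by rewrite eqxx hi.
have Ms : (M < size s)%N.
  by rewrite ltnNge; apply/negP => h; move: gs; rewrite ltnNge mulnC (leq_trans _ eM) ?leq_mul2l ?h ?orbT.
rewrite mem_iota (leqW (ltnW Ms)) !addnS !ltnS /=.
exact: leq_trans sz (leq_addl _ _).
Qed.

Theorem theorem1p9 (R : realType) (eps : R) (heps : 0 < eps) :
  exists N : nat, exists g0 : nat, forall g : nat, (g0 <= g)%N ->
    (nb_semigroups_far N g)%:R / (nb_semigroups g)%:R < eps.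
Proof.
have x0 := gold_gt0 R; have x1 := gold_lt1 R.
(* Four kinds of far words weigh at most eta each, and 4 eta is less than eps x <= eps n_g x^g. *)
pose eta : R := eps * gold R / 5.
have eta0 : 0 < eta by rewrite /eta; have := mulr_gt0 heps x0; lra.
have [Cm [rm [Cm0 rm0 rm1 hmid]]] := count_mid R.
have [N1 hN1] := expr_small ler01 x0 x1 eta0.
have Cm1 : 0 <= Cm / (1 - rm) by rewrite divr_ge0 // subr_ge0 ltW.
have [N2 hN2] := expr_small Cm1 rm0 rm1 eta0.
(* One factor r^g pays for the number of short words, the other makes their weight small. *)
have [r [r0 r1 xr]] := root_above 2 x0 x1.
have [e e0 hshort] := count_short r0 r1.
have [G1 hG1] := expr_small ler01 r0 r1 eta0.
have [Ch [rh [Ch0 rh0 rh1 hhigh]]] := count_high R e0.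
have Ch1 : 0 <= Ch / (1 - rh) by rewrite divr_ge0 // subr_ge0 ltW.
have [M1 hM1] := expr_small Ch1 rh0 rh1 eta0.
(* The successor makes positions beyond N at least 2, as [count_mid] requires; [count_high] requires
   lengths m >= 4. *)
pose N := (maxn N1 N2).+1; pose M := maxn 4 M1.
exists N, (maxn G1 (maxn (2 * N) (e * M))) => g.
rewrite !geq_max => /and3P[gG1 gN gM].
have [Ws [uW sW farW hW W12]] := words_of_genus g.
have y0 : 0 < gold R ^+ g by rewrite exprn_gt0.
have lower : gold R <= (nb_semigroups g)%:R * gold R ^+ g.
  apply: le_trans (size_words12_ge R g) _; rewrite ler_wpM2r ?(ltW y0) // ler_nat -sW.
  apply: uniq_leq_size (words12_uniq g) _ => s.
  by rewrite mem_words12 => /andP[s12 /eqP sg]; exact: W12.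
have b1 : (count (far_low N) Ws)%:R * gold R ^+ g <= eta.
  apply: (@le_trans _ _ (gold R ^+ N)); last first.
    by have := hN1 N; rewrite mul1r; apply; rewrite leqW // leq_maxl.
  have Ng : (N <= g)%N by apply: leq_trans gN; rewrite leq_pmull.
  apply: (@le_trans _ _ ((size (words12 (g - N)))%:R * gold R ^+ g)).
    by rewrite ler_wpM2r ?(ltW y0) // ler_nat count_far_low.
  rewrite -{2}(subnK Ng) exprD mulrA -[leRHS]mul1r ler_wpM2r ?exprn_ge0 ?(ltW x0) //.
  exact: size_words12_le.
have b2 : (count (fun s => size s * e <= g)%N Ws)%:R * gold R ^+ g <= eta.
  apply: le_trans (_ : r ^+ g <= _); last by have := hG1 g gG1; rewrite mul1r.
  apply: (@le_trans _ _ ((count (fun s => size s * e <= g)%N Ws)%:R * (r ^+ g * r ^+ g))).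
    by rewrite ler_wpM2l // -exprMn -expr2 lerXn2r // nnegrE ?exprn_ge0 // ltW.
  rewrite mulrA -[leRHS]mul1r ler_wpM2r ?exprn_ge0 ?(ltW r0) //.
  exact: hshort.
have b3 : (count (fun s => has (mid_at^~ s) (iota N.+1 g.+1)) Ws)%:R * gold R ^+ g <= eta.
  apply: le_trans (@count_tail R _ mid_at Ws N.+1 g.+1 Cm rm _ Cm0 rm0 rm1 (ltW y0) _) _.
    by move=> n hn; apply: hmid => //; apply: leq_trans hn.
  by rewrite mulrA mulrAC; apply: hN2; rewrite !leqW // leq_maxr.
have b4 : (count (fun s => has (fun n => [&& (size s).+1 == n, g < size s * e & far_high s])%N
    (iota M g.+2)) Ws)%:R * gold R ^+ g <= eta.
  apply: le_trans (@count_tail R _ (fun n s => [&& (size s).+1 == n, g < size s * e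
    & far_high s])%N Ws M g.+2 Ch rh _ Ch0 rh0 rh1 (ltW y0) _) _.
    by move=> n hn; apply: hhigh => //; apply: leq_trans hn; rewrite leq_maxl.
  by rewrite mulrA mulrAC; apply: hM1; rewrite leq_maxr.
have upper : (nb_semigroups_far N g)%:R * gold R ^+ g <= 4 * eta.
  set P1 := far_low N in b1; set P2 := (fun s => _) in b2.
  set P3 := (fun s => _) in b3; set P4 := (fun s => _) in b4.
  have hcount : (nb_semigroups_far N g <= count P1 Ws + (count P2 Ws + (count P3 Ws + count P4 Ws)))%N.
    apply: leq_trans (farW N) _.
    apply: (@leq_trans (count (fun s => [|| P1 s, P2 s, P3 s | P4 s]) Ws)).
      rewrite -!size_filter; apply: uniq_leq_size; first exact: filter_uniq.
      move=> s; rewrite !mem_filter => /andP[far sWs]; rewrite sWs andbT.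
      by have [ks sg] := hW s sWs; exact: far_cover ks sg gM far.
    apply: leq_trans (count_predU_le _ _ _) _; rewrite leq_add2l.
    apply: leq_trans (count_predU_le _ _ _) _; rewrite leq_add2l.
    exact: count_predU_le.
  rewrite -(ler_nat R) !natrD in hcount.
  have := ler_wpM2r (ltW y0) hcount; rewrite !mulrDl; lra.
have nb0 : 0 < (nb_semigroups g)%:R :> R.
  by rewrite -(pmulr_lgt0 _ y0); apply: lt_le_trans lower.
rewrite ltr_pdivrMr // -(ltr_pM2r y0) -mulrA.
apply: le_lt_trans upper _; apply: lt_le_trans (ler_wpM2l (ltW heps) lower).
by rewrite /eta; have := mulr_gt0 heps x0; lra.
Qed.
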